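(* There exist absolute constants $K>0$ and $C>0$ such that the following holds. Let $a$ be any nonzero integer, and let $s=2$ if $a$ is odd and $s=1$ if $a$ is even. Then for all positive integers $k$ and all real $x\ge 2|a|$, \[ \#\Big\{ p \text{ prime} : -a<p\le x,\ s\mid p+a,\ \omega\Big(\frac{p+a}{s}\Big)=k\Big\} \le K\,\frac{|a|}{\phi(|a|)}\,\pi(x)\,\frac{(\log\log x+C)^{k-1}}{(k-1)!\,\log x}. \]
   Context: $\omega(n)$ denotes the number of distinct prime factors of the positive integer $n$, $\phi$ is Euler's totient function, and $\pi(x)$ is the number of primes $\le x$. The convention $0^0=1$ is used. *)

(* Defs.v *)
From mathcomp Require Import all_boot all_order all_algebra.
From mathcomp Require Import reals exp.

Set Implicit Arguments.
Unset Strict Implicit.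
Unset Printing Implicit Defensive.

Import Order.TTheory GRing.Theory Num.Theory.

Local Open Scope ring_scope.

Definition omega (n : nat) : nat := size (primes n).

(* Num.truncn x is the floor of x when 0 <= x and is 0 when x < 0; since 0 is
   not prime, this lists without repetition exactly the primes p <= x, for every
   real x. *)
Definition primes_le (R : realType) (x : R) : seq nat :=
  [seq p <- iota 0 (Num.truncn x).+1 | prime p].

Definition prime_pi (R : realType) (x : R) : nat := size (primes_le x).

Definition parity_divisor (a : int) : int := if odd `|a|%N then 2 else 1.

(* In the predicate below p + a > 0 and s divides p + a, so %/ is an exact
   division with positive quotient and the absolute value is only a cast from
   int to nat. *)
Definition shifted_prime_count (R : realType) (a : int) (k : nat) (x : R) : nat :=
  let s := parity_divisor a in
  count (fun p : nat =>
           [&& - a < p%:Z,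
               (s %| p%:Z + a)%Z
             & omega `|((p%:Z + a) %/ s)%Z|%N == k])
        (primes_le x).

(* Main.v *)
Require Import Defs.
From mathcomp Require Import all_boot all_order all_algebra.
From mathcomp Require Import reals sequences exp.
From mathcomp Require Import zify ring lra.

(** The statement is proved by sieving and by Rankin's method.

    Put [Y = 2 x] and write [(p + a) / s = h n], where [n] is the power of the
    largest prime factor. Then [omega h = k - 1], and every prime factor of [h]
    is less than [n <= Y / h] (lemma [top_power_split]). For a fixed [h] one
    counts the prime powers [n <= M = Y / h] for which [s h n - a] is prime.
    Apart from a few small cases, such an [n] has no prime factor up to a small
    power of [M], and neither has [s h n - a], so that Selberg's sieve in
    dimension 2 gives the bound
    [C (|a| / phi |a|) (h / phi h) M / ln M ^ 2] (theorem [fiber_bound]).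

    Selberg's sieve is used in an orthogonal form that has no quadratic form to
    diagonalize. For each prime [p] let [sieve_char p] be the function on the
    residues modulo [p] that equals [g p] off the sieved classes and [-1] on
    them, where [g p] is chosen so that the mean is zero. The products of these
    functions over squarefree [l <= D] are orthogonal by the Chinese remainder
    theorem, and their sum equals the constant [G = sum of g l] on the unsieved
    integers. As its mean square is again [G], at most about [N / G] integers
    below [N] remain (theorem [selberg_sieve]). A comparison with the square of
    the harmonic sum, one prime at a time, shows that [G] is at least a multiple
    of [ln D ^ 2], up to Euler factors at the primes that divide [a h] (lemma
    [sieve_sum_ge]).

    It remains to bound the sum of [1 / (phi h ln (Y / h) ^ 2)] over the [h] with
    [omega h = k - 1] and with all prime factors at most [Y / h]. Cut it according
    to [2 ^ j <= ln Y / ln (Y / h) < 2 ^ j.+1]. In the [j]-th range the prime factors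
    of [h] are at most [y = Y ^ (2 ^ - j)], whereas [h >= Y ^ (1 - 2 ^ - j)], and so
    inserting [h ^ delta] with [delta] of size [1 / ln y] gains a factor that is
    exponentially small in [2 ^ j]; this beats the loss of [4 ^ j] from the
    logarithm. Without the condition on the size of [h], the sum over [h] of the
    multiplicative function [h ^ delta / phi h] is at most
    [S ^ (k - 1) / (k - 1)!], where [S] is its sum over prime powers (lemma
    [smooth_omega_sum_le]), and Mertens' theorems give [S <= ln (ln Y) + O(1)]
    (lemma [rankin_prime_power_sum_le]). The coefficient of [ln (ln Y)] is exactly
    1, and every other loss is a constant factor that does not depend on [k]:
    this is why the bound is uniform in [k]. Chebyshev's lower bound for
    [prime_pi] puts the result in the form of the statement. *)

Set Implicit Arguments.
Unset Strict Implicit.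
Unset Printing Implicit Defensive.

Import Order.TTheory GRing.Theory Num.Theory.

Local Open Scope ring_scope.

(** * Chebyshev's estimates *)

Lemma prod_primes_dvd (s : seq nat) (N : nat) :
  uniq s -> all prime s -> all (fun p => p %| N)%N s ->
  (\prod_(p <- s) p %| N)%N.
Proof.
elim: s => [|p s IH]; first by rewrite big_nil dvd1n.
move=> /= /andP[ps us] /andP[pp aps] /andP[pN asN].
rewrite big_cons Gauss_dvd ?pN ?IH //.
rewrite big_seq; elim/big_rec: _ => [|q m qs IHm]; first exact: coprimen1.
rewrite coprimeMr IHm andbT prime_coprime // dvdn_prime2 ?(allP aps q qs) //.
by apply: contraNN ps => /eqP ->.
Qed.

Lemma bin_odd_le (m : nat) : ('C(m.*2.+1, m) <= 4 ^ m)%N.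
Proof.
suff H : ('C(m.*2.+1, m).*2 <= (4 ^ m).*2)%N by rewrite leq_double in H.
have -> : (4 ^ m).*2 = (2 ^ m.*2.+1)%N.
  by rewrite expnS -muln2 mulnC -mul2n expnM.
rewrite -(addn1 1) expnDn.
have mm : (m < m.*2.+1)%N by lia.
have mm2 : (m.+1 < m.*2.+2)%N by lia.
rewrite (bigD1 (Ordinal (ltnW mm2))) //= (bigD1 (Ordinal mm2)) /=; last first.
  by rewrite -val_eqE /= neq_ltn ltnSn orbT.
rewrite !exp1n !muln1.
have -> : 'C(m.*2.+1, m.+1) = 'C(m.*2.+1, m).
  by rewrite -bin_sub; [congr binomial|]; lia.
lia.
Qed.

(** For odd [n = 2m+1], the primes in [[m+2, 2m+1]] all divide ['C(2m+1, m)], which is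
    at most [4 ^ m]. *)
Lemma primorial_le (n : nat) :
  (\prod_(0 <= p < n.+1 | prime p) p <= 4 ^ n)%N.
Proof.
have [k] := ubnP n; elim: k n => // k IH n; rewrite ltnS => nk.
case: (ltnP n 3) => n3.
  by case: n n3 {nk} => [|[|[|]]] // _; rewrite unlock.
have [on|en] := boolP (odd n); last first.
  rewrite big_mkcond big_nat_recr //= -big_mkcond /=.
  have -> : prime n = false.
    apply/negbTE/negP => /even_prime[]; first lia.
    by rewrite (negbTE en).
  rewrite muln1; case: n n3 nk {en} => // n n3 nk.
  by apply: leq_trans (IH n _) _; rewrite ?leq_exp2l; lia.
have [m nE m1] : exists2 m, n = m.*2.+1 & (0 < m)%N.
  by exists n./2; lia.
rewrite nE (@big_cat_nat _ _ _ m.+2) //=; last by lia.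
have -> : (4 ^ m.*2.+1 = 4 ^ m.+1 * 4 ^ m)%N by rewrite -expnD; congr expn; lia.
apply: leq_mul; first by apply: IH; lia.
apply: leq_trans (bin_odd_le m).
apply: dvdn_leq; first by rewrite bin_gt0; lia.
rewrite -big_filter; apply: prod_primes_dvd.
- exact/filter_uniq/iota_uniq.
- exact: filter_all.
- apply/allP => p; rewrite mem_filter mem_index_iota => /and3P[pp p1 p2].
  have : (p %| (m.*2.+1)`!)%N.
    by rewrite dvdn_fact // prime_gt0 //; lia.
  have mm : (m <= m.*2.+1)%N by lia.
  rewrite -(bin_fact mm) !Euclid_dvdM //.
  have -> : (m.*2.+1 - m = m.+1)%N by lia.
  have D k' : (k' <= m.+1)%N -> (p %| k'`!)%N = false.
    move=> kk; apply/negbTE; rewrite fact_prod -big_filter /=.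
    apply/negP; rewrite Euclid_dvd_prod // big_has => /hasP[i].
    rewrite mem_filter mem_index_iota /= => /andP[i1 i2] /dvdn_leq; lia.
  by rewrite !D ?orbF //; lia.
Qed.

Lemma central_bin_ge (n : nat) : (2 ^ n <= 'C(n.*2, n))%N.
Proof.
elim: n => // n IH.
rewrite doubleS binS expnS mul2n -addnn.
have H1 : ('C(n.*2, n) <= 'C(n.*2.+1, n.+1))%N by rewrite binS leq_addl.
have E : 'C(n.*2.+1, n) = 'C(n.*2.+1, n.+1).
  by rewrite -(@bin_sub _ n); [congr binomial|]; lia.
by rewrite E leq_add // (leq_trans IH).
Qed.

(** Kummer: each term of Legendre's sum contributes at most one to the
    valuation, and only the terms with [p ^ k <= 2n] contribute. *)
Lemma logn_central_bin (n p : nat) :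
  (0 < n)%N -> prime p -> (p ^ logn p 'C(n.*2, n) <= n.*2)%N.
Proof.
move=> n0 pp; have p1 := prime_gt1 pp.
set T := trunc_log p n.*2.
apply: (@leq_trans (p ^ T)); last by apply: trunc_logP => //; lia.
rewrite leq_exp2l //.
have nn : (n <= n.*2)%N by lia.
have := congr1 (logn p) (bin_fact nn).
have -> : (n.*2 - n = n)%N by lia.
rewrite !lognM ?fact_gt0 ?bin_gt0 ?muln_gt0 ?fact_gt0 //; try by lia.
rewrite !logn_fact //.
have T2 : (T <= n.*2)%N.
  by apply: ltnW; apply: leq_trans (ltn_expl T p1) _; apply: trunc_logP => //; lia.
set A := (\sum_(1 <= k < n.+1) n %/ p ^ k)%N.
have -> : A = (\sum_(1 <= k < n.*2.+1) n %/ p ^ k)%N.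
  rewrite (@big_cat_nat _ _ _ n.+1 1%N n.*2.+1) //=.
  rewrite -/A [X in (_ + X)%N]big_nat big1 ?addn0 // => k /andP[k1 k2].
  by rewrite divn_small // (leq_trans k1) // ltnW // ltn_expl.
move=> E.
suff H : (\sum_(1 <= k < n.*2.+1) n.*2 %/ p ^ k <=
   T + (\sum_(1 <= k < n.*2.+1) n %/ p ^ k +
        \sum_(1 <= k < n.*2.+1) n %/ p ^ k))%N by lia.
rewrite -big_split /=.
rewrite (@big_cat_nat _ _ _ T.+1 1%N) //= [in leqRHS](@big_cat_nat _ _ _ T.+1 1%N) //=.
have -> : (\sum_(T.+1 <= k < n.*2.+1) n.*2 %/ p ^ k = 0)%N.
  rewrite big_nat big1 // => k /andP[k1 _]; rewrite divn_small //.
  by apply: leq_trans (trunc_log_ltn _ p1) _; rewrite leq_exp2l.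
rewrite addn0 addnA; apply: leq_trans (leq_addr _ _).
rewrite -[X in (X + _)%N](_ : (\sum_(1 <= k < T.+1) 1)%N = T); last first.
  by rewrite sum_nat_const_nat; lia.
rewrite -big_split /=; apply: leq_sum => k _.
have pk : (0 < p ^ k)%N by rewrite expn_gt0 prime_gt0.
have := divn_eq n (p ^ k); have := ltn_pmod n pk.
set q := (n %/ _)%N; set r := (n %% _)%N => rp nE.
have -> : (n.*2 = (q + q) * p ^ k + (r + r))%N by rewrite mulnDl; lia.
rewrite divnMDl //.
have : ((r + r) %/ p ^ k < 2)%N by rewrite ltn_divLR //; lia.
lia.
Qed.

Lemma central_bin_le (n : nat) : (0 < n)%N ->
  ('C(n.*2, n) <= n.*2 ^ count prime (iota 0 n.*2.+1))%N.
Proof.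
move=> n0; have C0 : (0 < 'C(n.*2, n))%N by rewrite bin_gt0; lia.
rewrite -size_filter; set s := filter _ _.
have -> : (n.*2 ^ size s = \prod_(p <- s) n.*2)%N by rewrite big_const_seq count_predT iter_muln_1.
apply: (@leq_trans (\prod_(p <- s) p ^ logn p 'C(n.*2, n))); last first.
  rewrite !big_seq; apply: leq_prod => p; rewrite mem_filter => /andP[pp _].
  exact: logn_central_bin.
rewrite [X in (X <= _)%N](prod_prime_decomp C0) prime_decompE big_map /=.
have sub : {subset primes 'C(n.*2, n) <= s}.
  move=> p; rewrite mem_primes => /and3P[pp _ pC].
  rewrite mem_filter pp mem_iota /= add0n ltnS.
  have : (p %| (n.*2)`!)%N.
    have nn : (n <= n.*2)%N by lia.
    by rewrite -(bin_fact nn) dvdn_mulr.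
  rewrite fact_prod Euclid_dvd_prod // big_has => /hasP[i].
  rewrite mem_index_iota /= => /andP[i1 i2] /dvdn_leq; lia.
have pe : perm_eq s
    (primes 'C(n.*2, n) ++ [seq p <- s | p \notin primes 'C(n.*2, n)]).
  apply: uniq_perm; first exact/filter_uniq/iota_uniq.
    rewrite cat_uniq primes_uniq filter_uniq ?filter_uniq ?iota_uniq // andbT.
    by apply/hasPn => p; rewrite mem_filter => /andP[].
  move=> p; rewrite mem_cat [in RHS]mem_filter.
  by case: (boolP (p \in primes _)) => //= /sub ->.
rewrite [leqRHS](perm_big _ pe) big_cat /= leq_pmulr // big_seq_cond.
by rewrite prodn_cond_gt0 // => p; rewrite 2!mem_filter => /andP[/and3P[_ pp _] _];
  rewrite expn_gt0 prime_gt0.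
Qed.

(** * Mertens' estimates *)

Lemma ln_nat_ge0 (R : realType) (n : nat) : 0 <= ln (n%:R : R).
Proof.
case: n => [|n]; first by rewrite ln0.
by apply: ln_ge0; rewrite ler1n.
Qed.

Lemma ln_prod (R : realType) (I : eqType) (s : seq I) (P : pred I) (F : I -> nat) :
  (forall i, P i -> 0 < F i)%N ->
  ln ((\prod_(i <- s | P i) F i)%N%:R : R) = \sum_(i <- s | P i) ln (F i)%:R.
Proof.
move=> F0; elim: s => [|i s IH]; first by rewrite !big_nil ln1.
rewrite !big_cons; case: ifP => // Pi.
rewrite natrM lnM ?IH // posrE ltr0n ?F0 //.
by rewrite prodn_cond_gt0.
Qed.

Lemma theta_le (R : realType) (n : nat) :
  \sum_(0 <= p < n.+1 | prime p) ln (p%:R : R) <= n%:R * ln 4.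
Proof.
rewrite -ln_prod; last exact: prime_gt0.
rewrite mulr_natl -lnXn ?ltr0n // ler_ln ?posrE.
- by rewrite -natrX ler_nat primorial_le.
- by rewrite ltr0n prodn_cond_gt0 // => p /prime_gt0.
- by rewrite exprn_gt0.
Qed.

Lemma fact_le_expn (n : nat) : (n`! <= n ^ n)%N.
Proof.
elim: n => // n IH; rewrite factS expnS leq_mul2l /=.
by apply: leq_trans IH _; case: n => // n; rewrite leq_exp2r.
Qed.

(** By Legendre, [p] divides [n!] at least [n %/ p] times. *)
Lemma sum_ln_floor_le (R : realType) (n : nat) :
  \sum_(0 <= p < n.+1 | prime p) (n %/ p)%:R * ln (p%:R : R) <= n%:R * ln n%:R.
Proof.
have -> : \sum_(0 <= p < n.+1 | prime p) (n %/ p)%:R * ln (p%:R : R) =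
    ln ((\prod_(0 <= p < n.+1 | prime p) p ^ (n %/ p))%N%:R : R).
  rewrite ln_prod; last by move=> p pp; rewrite expn_gt0 prime_gt0.
  apply: eq_bigr => p pp.
  by rewrite natrX lnXn ?mulr_natl // ltr0n prime_gt0.
case: n => [|n]; first by rewrite mul0r unlock /= ln1.
rewrite mulr_natl -lnXn // ler_ln ?posrE.
- rewrite -natrX ler_nat; apply: leq_trans (fact_le_expn _).
  apply: (@leq_trans (\prod_(0 <= p < n.+2 | prime p) p ^ logn p (n.+1)`!)).
    apply: leq_prod => p pp; rewrite leq_exp2l ?prime_gt1 // logn_fact //.
    by rewrite big_nat_recl // expn1 leq_addr.
  rewrite [leqRHS](prod_prime_decomp (fact_gt0 _)) prime_decompE big_map /=.
  apply: eq_leq; rewrite -big_filter; apply: perm_big.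
  apply: uniq_perm; rewrite ?primes_uniq ?filter_uniq ?iota_uniq // => p.
  rewrite mem_filter mem_index_iota mem_primes fact_gt0 /= ltnS.
  case pp: (prime p) => //=; apply/idP/idP => [pn|].
    by rewrite dvdn_fact // prime_gt0.
  rewrite fact_prod Euclid_dvd_prod // big_has => /hasP[i].
  by rewrite mem_index_iota /= => /andP[i1 i2] /dvdn_leq; lia.
- by rewrite ltr0n prodn_cond_gt0 // => p pp; rewrite expn_gt0 prime_gt0.
- by rewrite exprn_gt0.
Qed.

(** Replacing [n / p] by its floor loses at most [theta n], hence [n ln 4]. *)
Lemma mertens_first_le (R : realType) (n : nat) : (0 < n)%N ->
  \sum_(0 <= p < n.+1 | prime p) ln p%:R / p%:R <= ln n%:R + ln 4 :> R.
Proof.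
move=> n0; have n0' : 0 < n%:R :> R by rewrite ltr0n.
rewrite -(ler_pM2l n0') mulrDr mulr_sumr.
apply: le_trans (lerD (sum_ln_floor_le R n) (theta_le R n)).
rewrite -big_split /=; apply: ler_sum => p pp.
have p0 : 0 < p%:R :> R by rewrite ltr0n prime_gt0.
have lp := ln_nat_ge0 R p.
have : n%:R <= ((n %/ p)%:R + 1) * p%:R :> R.
  rewrite natr1 -natrM ler_nat.
  by have := divn_eq n p; have := ltn_pmod n (prime_gt0 pp); nia.
rewrite -ler_pdivrMr // => H.
have -> : n%:R * (ln p%:R / p%:R) = n%:R / p%:R * ln p%:R :> R by ring.
have -> : (n %/ p)%:R * ln p%:R + ln p%:R = ((n %/ p)%:R + 1) * ln p%:R :> R by ring.
by apply: ler_wpM2r.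
Qed.

(** Abel summation against [1 / ln n], carried out as an induction: the last
    two terms absorb the boundary sums, and
    [1 - ln n / ln (n+1) <= ln (ln (n+1) / ln n)]. *)
Lemma mertens_second_aux (R : realType) (c : R) (n : nat) :
  (forall m, (2 <= m)%N -> \sum_(0 <= p < m.+1 | prime p) ln p%:R / p%:R <= ln m%:R + c) ->
  (2 <= n)%N ->
  \sum_(0 <= p < n.+1 | prime p) p%:R^-1 <=
    (\sum_(0 <= p < n.+1 | prime p) ln p%:R / p%:R) / ln n%:R
    + (ln (ln n%:R) - ln (ln 2)) + c * ((ln 2)^-1 - (ln n%:R)^-1) :> R.
Proof.
move=> HA; have l2 : 0 < ln 2 :> R by apply: ln_gt0; lra.
elim: n => // n IH; rewrite ltnS leq_eqVlt => /orP[/eqP <-|n2].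
  rewrite !subrr mulr0 !addr0 unlock /= !addr0.
  by rewrite mulrC mulrA mulVf ?mul1r ?gt_eqF.
have {}IH := IH n2.
have n1 : 1 < n%:R :> R by rewrite ltr1n.
have l1 : 0 < ln n%:R :> R by apply: ln_gt0.
have l3 : ln n%:R < ln n.+1%:R :> R by rewrite ltr_ln ?posrE ?ltr0n ?ltr_nat //; lia.
have l4 : 0 < ln n.+1%:R :> R by apply: lt_trans l3.
have HAn := HA n n2.
rewrite [in leLHS]big_mkcond [in X in _ <= X / _ + _ + _]big_mkcond /=.
rewrite ![\sum_(0 <= p < n.+2) _]big_nat_recr //= -!big_mkcond /=.
set S := \sum_(_ <= _ < _ | _) _^-1 in IH *.
set B := \sum_(_ <= _ < _ | _) _ in HAn IH *.
set a := ln n%:R in l1 l3 HAn IH *; set b := ln n.+1%:R in l3 l4 *.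
have -> : (B + (if prime n.+1 then b / n.+1%:R else 0)) / b =
   B / b + (if prime n.+1 then n.+1%:R^-1 else 0).
  case: ifP => _; last by rewrite !addr0.
  by rewrite mulrDl; congr (_ + _); rewrite mulrAC mulfV ?mul1r ?gt_eqF.
have D : 1 - a / b <= ln b - ln a.
  have := @le_ln1Dx R (a / b - 1).
  have -> : 1 + (a / b - 1) = a / b by ring.
  rewrite ln_div ?posrE // => /(_ _); rewrite ltrBrDr addNr divr_gt0 // => /(_ isT); lra.
have E : (B - c) * (a^-1 - b^-1) <= 1 - a / b.
  have -> : 1 - a / b = a * (a^-1 - b^-1) by field; rewrite ?gt_eqF.
  apply: ler_wpM2r; last lra.
  by rewrite subr_ge0 lef_pV2 ?posrE // ltW.
have {E} := le_trans E D; set i := (if _ then _ else _) => E.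
move: IH E; rewrite mulrBl !mulrBr; lra.
Qed.

Lemma mertens_second_le (R : realType) : exists c : R, forall n : nat, (2 <= n)%N ->
  \sum_(0 <= p < n.+1 | prime p) p%:R^-1 <= ln (ln n%:R) + c.
Proof.
have l2 : 0 < ln 2 :> R by apply: ln_gt0; lra.
have l4 : 0 < ln 4 :> R by apply: ln_gt0; lra.
exists (1 + ln 4 / ln 2 - ln (ln 2)) => n n2.
have H m : (2 <= m)%N -> \sum_(0 <= p < m.+1 | prime p) ln p%:R / p%:R <= ln m%:R + ln 4 :> R.
  by move=> m2; apply: mertens_first_le; lia.
apply: le_trans (mertens_second_aux H n2) _.
have n1 : 1 < n%:R :> R by rewrite ltr1n.
have l1 : 0 < ln n%:R :> R by apply: ln_gt0.
have := H n n2; set B := \sum_(_ <= _ < _ | _) _ => HB.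
have : B / ln n%:R <= 1 + ln 4 / ln n%:R.
  by rewrite ler_pdivrMr // mulrDl mul1r divfK ?gt_eqF.
lra.
Qed.

Lemma prime_pi_ge (R : realType) : exists2 c : R, 0 < c &
  forall x : R, 2 <= x -> c * (x / ln x) <= (prime_pi x)%:R.
Proof.
have l2 : 0 < ln 2 :> R by apply: ln_gt0; lra.
exists (ln 2 / 4) => [|x x2]; first by apply: divr_gt0 => //; lra.
have lx : 0 < ln x by apply: ln_gt0; lra.
rewrite mulrA ler_pdivrMr //.
set N := Num.truncn x; have x0 : 0 <= x by lra.
have /andP[N1 N2] := truncn_itv x0.
have N3 : (2 <= N)%N by rewrite truncn_ge_nat.
set n := N./2.
have n0 : (0 < n)%N by rewrite /n; lia.
have xn : x <= 4 * n%:R.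
  apply: le_trans (ltW N2) _; rewrite -/N -natrM ler_nat /n; lia.
have nx : (n.*2)%:R <= x by apply: le_trans N1; rewrite ler_nat -/N /n; lia.
have H : (2 ^ n <= n.*2 ^ prime_pi x)%N.
  apply: leq_trans (central_bin_ge n) _; apply: leq_trans (central_bin_le n0) _.
  rewrite leq_exp2l; last by lia.
  rewrite /prime_pi /primes_le size_filter -/N.
  have -> : N.+1 = (n.*2.+1 + (N - n.*2))%N by rewrite /n; lia.
  by rewrite iotaD count_cat leq_addr.
have {}H : n%:R * ln 2 <= (prime_pi x)%:R * ln x :> R.
  apply: (@le_trans _ _ ((prime_pi x)%:R * ln (n.*2)%:R)).
    rewrite !mulr_natl -!lnXn ?ltr0n ?double_gt0 // ler_ln ?posrE ?exprn_gt0 ?ltr0n ?double_gt0 //.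
    by rewrite -!natrX ler_nat.
  by apply: ler_wpM2l => //; rewrite ler_ln ?posrE ?ltr0n ?double_gt0 //; lra.
apply: le_trans H.
rewrite [X in X <= _](_ : _ = x / 4 * ln 2); last by ring.
by apply: ler_wpM2r; lra.
Qed.

(** * Sums of periodic functions *)

Definition periodic (T : Type) (q : nat) (f : nat -> T) := forall n, f (n + q)%N = f n.

Lemma periodic_addM (T : Type) (q : nat) (f : nat -> T) (k n : nat) :
  periodic q f -> f (k * q + n)%N = f n.
Proof.
move=> fq; elim: k => [|k IH]; first by rewrite mul0n add0n.
by rewrite mulSnr addnAC fq.
Qed.

Lemma periodic_mod (T : Type) (q : nat) (f : nat -> T) (n : nat) :
  periodic q f -> f (n %% q)%N = f n.
Proof. by move=> fq; rewrite [in RHS](divn_eq n q) periodic_addM. Qed.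

Lemma sum_nat_blocks (V : zmodType) (q k : nat) (f : nat -> V) :
  \sum_(0 <= n < k * q) f n = \sum_(0 <= j < k) \sum_(0 <= r < q) f (j * q + r)%N.
Proof.
elim: k => [|k IH]; first by rewrite mul0n !big_geq.
rewrite big_nat_recr //= -IH mulSnr (@big_cat_nat _ _ _ (k * q)) //= ?leq_addr //.
by congr (_ + _); rewrite -{1}[(k * q)%N]add0n big_addn addKn; apply: eq_bigr => i _; rewrite addnC.
Qed.

Lemma sum_periodic_progression (R : comNzRingType) (p m r : nat) (e : nat -> R) :
  (0 < p)%N -> coprime p m -> periodic p e ->
  \sum_(0 <= j < p) e (j * m + r)%N = \sum_(0 <= n < p) e n.
Proof.
move=> p0 pm pe.
under eq_bigr do rewrite -(periodic_mod _ pe).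
rewrite -(big_map (fun j => (j * m + r) %% p)%N xpredT e) /=.
apply: perm_big; rewrite /index_iota subn0.
set s := map _ _.
have us : uniq s.
  rewrite map_inj_in_uniq ?iota_uniq // => i j.
  rewrite !mem_iota !add0n /= => ip jp /eqP.
  rewrite eqn_modDr.
  wlog ij : i j ip jp / (i <= j)%N.
    by move=> H; case: (leqP i j) => [|/ltnW] ij; [exact: H|rewrite eq_sym => /H ->].
  rewrite eq_sym eqn_mod_dvd ?leq_mul2r ?ij ?orbT // -mulnBl Gauss_dvdl //.
  case: (posnP (j - i)) => [|ji /dvdn_leq]; lia.
have sub : {subset s <= iota 0 p}.
  by move=> x /mapP[j _ ->]; rewrite mem_iota add0n /= ltn_pmod.
apply: uniq_perm; rewrite ?iota_uniq // => x.
by have [] := uniq_min_size us sub; rewrite ?size_map.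
Qed.

Lemma sum_coprime_periodic (R : comNzRingType) (p m : nat) (e F : nat -> R) :
  (0 < p)%N -> coprime p m -> periodic p e -> periodic m F ->
  \sum_(0 <= n < p * m) e n * F n
  = (\sum_(0 <= n < p) e n) * (\sum_(0 <= n < m) F n).
Proof.
move=> p0 pm pe pF; rewrite sum_nat_blocks exchange_big /= mulr_sumr.
apply: eq_bigr => r _.
under eq_bigr do rewrite (periodic_addM _ _ pF).
by rewrite -mulr_suml sum_periodic_progression.
Qed.

(** The Chinese remainder theorem, in the form in which it gives orthogonality. *)
Lemma sum_prod_periodic (R : comNzRingType) (U : seq nat) (e : nat -> nat -> R) :
  uniq U -> all prime U -> (forall p, periodic p (e p)) ->
  \sum_(0 <= n < \prod_(p <- U) p) \prod_(p <- U) e p n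
  = \prod_(p <- U) \sum_(0 <= n < p) e p n.
Proof.
move=> + + pe; elim: U => [|p U IH]; first by rewrite !big_nil big_nat1 big_nil.
move=> /= /andP[pU uU] /andP[pp aU]; rewrite !big_cons -IH //.
under eq_bigr do rewrite big_cons.
apply: sum_coprime_periodic => //; first exact: prime_gt0.
- rewrite big_seq; elim/big_rec: _ => [|q k qU IHk]; first exact: coprimen1.
  rewrite coprimeMr IHk andbT prime_coprime // dvdn_prime2 ?(allP aU q qU) //.
  by apply: contraNN pU => /eqP ->.
- move=> n; apply: eq_big_seq => q qU.
  have /dvdnP[k ->] : (q %| \prod_(j <- U) j)%N.
    by rewrite (perm_big _ (perm_to_rem qU)) big_cons dvdn_mulr.
  by rewrite addnC periodic_addM.
Qed.

(** A complete period contributes exactly; the incomplete one is at most [q]. *)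
Lemma sum_periodic_le (R : realFieldType) (q N : nat) (f : nat -> R) :
  (0 < q)%N -> periodic q f -> (forall n, `|f n| <= 1) ->
  \sum_(0 <= n < N) f n <= N%:R / q%:R * (\sum_(0 <= n < q) f n) + 2 * q%:R.
Proof.
move=> q0 pf f1.
have bnd k : `|\sum_(0 <= n < k) f n| <= k%:R.
  apply: le_trans (ler_norm_sum _ _ _) _.
  apply: le_trans (ler_sum _ (fun i _ => f1 i)) _.
  by rewrite sumr_const_nat subn0.
have -> : \sum_(0 <= n < N) f n = (\sum_(0 <= n < q) f n) *+ (N %/ q)
    + \sum_(0 <= n < N %% q) f n.
  rewrite {1}(divn_eq N q) (@big_cat_nat _ _ _ (N %/ q * q)) //= ?leq_addr //.
  congr (_ + _).
    rewrite sum_nat_blocks -[X in _ *+ X]subn0 -sumr_const_nat.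
    by apply: eq_bigr => j _; apply: eq_bigr => i _; rewrite periodic_addM.
  rewrite -{1}[(N %/ q * q)%N]add0n big_addn addKn.
  by apply: eq_bigr => i _; rewrite addnC periodic_addM.
set S := \sum_(0 <= n < q) _.
have qr : 0 < q%:R :> R by rewrite ltr0n.
have -> : N%:R / q%:R = (N %/ q)%:R + (N %% q)%:R / q%:R :> R.
  rewrite {1}(divn_eq N q) natrD natrM mulrDl mulfK ?gt_eqF //.
rewrite mulrDl mulr_natl -[leRHS]addrA lerD2l.
have b1 := le_trans (ler_norm _) (bnd (N %% q)%N).
have r1 : (N %% q)%:R <= q%:R :> R by rewrite ler_nat ltnW // ltn_pmod.
have b2 : - q%:R <= S by have := bnd q; rewrite ler_norml => /andP[].
have b3 : - q%:R <= (N %% q)%:R / q%:R * S.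
  apply: (@le_trans _ _ ((N %% q)%:R / q%:R * - q%:R)).
    by rewrite mulrN divfK ?gt_eqF // lerN2.
  by apply: ler_wpM2l => //; rewrite divr_ge0 ?ler0n.
lra.
Qed.

(** * Selberg's sieve *)

(** The squarefree numbers up to [x] composed of the primes of [ps], as lists of
    prime factors. The recursion on [ps] is the one of [smooth_sum_mul_le]. *)
Fixpoint sublists_le (ps : seq nat) (x : nat) : seq (seq nat) :=
  if ps is p :: ps' then
    sublists_le ps' x ++ map (cons p) (sublists_le ps' (x %/ p))
  else if (0 < x)%N then [:: [::]] else [::].

Lemma mem_sublists_le (ps : seq nat) (x : nat) (l : seq nat) :
  all prime ps -> l \in sublists_le ps x ->
  subseq l ps /\ (\prod_(p <- l) p <= x)%N.
Proof.
elim: ps x l => [|p ps IH] x l.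
  by case: x => //= x _; rewrite inE => /eqP ->; rewrite big_nil.
move=> /= /andP[pp aps]; rewrite mem_cat => /orP[/IH[] // s1 s2|].
  by split => //; apply: subseq_trans s1 (subseq_cons _ _).
move=> /mapP[l' /IH[] // s1 s2 ->]; split; first by rewrite /= eqxx.
by rewrite big_cons mulnC -leq_divRL ?prime_gt0.
Qed.

Lemma uniq_sublists_le (ps : seq nat) (x : nat) :
  uniq ps -> all prime ps -> uniq (sublists_le ps x).
Proof.
elim: ps x => [|p ps IH] x /=; first by case: ifP.
move=> /andP[pps ups] /andP[pp aps].
rewrite cat_uniq IH // map_inj_uniq ?IH ?andbT //=; last by move=> ? ? [].
apply/hasPn => l /mapP[l' _ ->]; apply/negP => /(mem_sublists_le aps)[/mem_subseq sl _].
by move: pps; rewrite sl ?mem_head.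
Qed.

Lemma subseq_filter_mem (ps l : seq nat) :
  uniq ps -> subseq l ps -> l = [seq p <- ps | p \in l].
Proof. by move=> ups /subseq_uniqP; exact. Qed.

(** Distinct lists have distinct products, by unique factorization. *)
Lemma size_sublists_le (ps : seq nat) (x : nat) :
  uniq ps -> all prime ps -> (size (sublists_le ps x) <= x)%N.
Proof.
move=> ups aps; rewrite -(size_map (fun l => \prod_(p <- l) p)%N).
rewrite -[leqRHS](size_iota 1 x); apply: uniq_leq_size.
  rewrite map_inj_in_uniq ?uniq_sublists_le // => l l'.
  move=> /(mem_sublists_le aps)[sl _] /(mem_sublists_le aps)[sl' _] ll.
  rewrite (subseq_filter_mem ups sl) (subseq_filter_mem ups sl').
  apply: eq_in_filter => p pps; have pp := allP aps p pps.
  have D (k : seq nat) : subseq k ps -> (p \in k) = (p %| \prod_(q <- k) q)%N.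
    move=> sk; apply/idP/idP => [pk|].
      by rewrite (perm_big _ (perm_to_rem pk)) big_cons dvdn_mulr.
    rewrite Euclid_dvd_prod // big_has => /hasP[q qk].
    by rewrite dvdn_prime2 ?(allP aps q) ?(mem_subseq sk) // => /eqP ->.
  by rewrite !D // ll.
move=> n /mapP[l /(mem_sublists_le aps)[/mem_subseq sl lx] ->].
rewrite mem_iota add1n ltnS lx andbT big_seq.
by rewrite prodn_cond_gt0 // => q /sl /(allP aps) /prime_gt0.
Qed.

(** [r p = 0] encodes that the class of 0 is the only one sieved modulo [p]. *)
Definition sieved (r : nat -> nat) (p n : nat) : bool :=
  (n %% p == 0)%N || (n %% p == r p)%N.

Definition num_sieved (r : nat -> nat) (p : nat) : nat := (r p != 0%N).+1.

Definition sieve_weight (R : realFieldType) (r : nat -> nat) (p : nat) : R :=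
  (num_sieved r p)%:R / (p%:R - (num_sieved r p)%:R).

(** A function of the residue modulo [p] with mean 0 and mean square
    [sieve_weight r p]. *)
Definition sieve_char (R : realFieldType) (r : nat -> nat) (p n : nat) : R :=
  if sieved r p n then -1 else sieve_weight R r p.

Definition sieve_sum (R : realFieldType) (r : nat -> nat) (ps : seq nat) (x : nat) : R :=
  \sum_(l <- sublists_le ps x) \prod_(p <- l) sieve_weight R r p.

(** The lower bound 4 on a prime with two sieved classes makes its weight at
    most 1. *)
Definition admissible (r : nat -> nat) (p : nat) : Prop :=
  prime p /\ (r p < p)%N /\ (r p != 0%N -> (4 <= p)%N).

Lemma num_sieved_lt r p : admissible r p -> ((num_sieved r p).*2 <= p)%N.
Proof.
move=> [/prime_gt1 p1 [_ H]]; rewrite /num_sieved.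
by case: eqP H => //= _ /(_ isT); lia.
Qed.

Lemma sieve_weight_bound (R : realFieldType) r p : admissible r p ->
  0 <= sieve_weight R r p <= 1.
Proof.
move=> /num_sieved_lt; rewrite /sieve_weight; set m := num_sieved r p => H.
have : m.*2%:R <= p%:R :> R by rewrite ler_nat.
have m0 : 1 <= m%:R :> R by rewrite ler1n.
rewrite -muln2 natrM => H1; have H2 : 0 < p%:R - m%:R :> R by lra.
rewrite ler_pdivrMr // mul1r divr_ge0 ?ler0n ?(ltW H2) //=; lra.
Qed.

Lemma sieve_char_bound (R : realFieldType) r p n : admissible r p ->
  `|sieve_char R r p n| <= 1.
Proof.
move=> /(sieve_weight_bound R) /andP[g0 g1]; rewrite /sieve_char.
by case: ifP => _; [rewrite normrN1|rewrite ger0_norm].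
Qed.

Lemma sieve_char_periodic (R : realFieldType) r p : periodic p (sieve_char R r p).
Proof. by move=> n; rewrite /sieve_char /sieved modnDr. Qed.

Lemma count_sieved r p : admissible r p ->
  count (sieved r p) (iota 0 p) = num_sieved r p.
Proof.
move=> [pp [rp _]]; have p0 := prime_gt0 pp.
rewrite -size_filter /num_sieved.
suff pe : perm_eq (filter (sieved r p) (iota 0 p))
    (0%N :: (if r p == 0%N then [::] else [:: r p])).
  by rewrite (perm_size pe); case: (r p == 0%N).
apply: uniq_perm; first exact/filter_uniq/iota_uniq.
  by case: eqP => //= /eqP r0; rewrite inE eq_sym r0.
move=> n; rewrite mem_filter mem_iota add0n /= /sieved inE.
case: (ltnP n p) => np; rewrite ?andbF ?andbT.
  rewrite modn_small //; case: (r p =P 0%N) => [->|_]; first by rewrite orbb orbF.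
  by rewrite inE.
rewrite (gtn_eqF (leq_trans p0 np)).
by case: (r p =P 0%N) => // _; rewrite inE (gtn_eqF (leq_trans rp np)).
Qed.

Lemma sum_if_sieved (R : realFieldType) r p (a b : R) : admissible r p ->
  \sum_(0 <= n < p) (if sieved r p n then a else b)
  = (num_sieved r p)%:R * a + (p%:R - (num_sieved r p)%:R) * b.
Proof.
move=> ad; transitivity (\sum_(0 <= n < p) (b + (if sieved r p n then a - b else 0))).
  by apply: eq_bigr => n _; case: ifP => _; ring.
rewrite big_split /= sumr_const_nat -big_mkcond /= big_const_seq subn0.
rewrite /index_iota subn0 count_sieved // iter_addr_0 -(mulr_natl b) -(mulr_natl (a - b)); ring.
Qed.

Lemma sieve_weight_denom (R : realFieldType) r p : admissible r p ->
  p%:R - (num_sieved r p)%:R != 0 :> R.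
Proof.
move=> /num_sieved_lt H; rewrite subr_eq0 eqr_nat.
by move: H; rewrite /num_sieved; lia.
Qed.

Lemma sum_sieve_char (R : realFieldType) r p : admissible r p ->
  \sum_(0 <= n < p) sieve_char R r p n = 0.
Proof.
move=> ad; rewrite /sieve_char sum_if_sieved // /sieve_weight.
by field; exact: sieve_weight_denom.
Qed.

Lemma sum_sieve_char_sqr (R : realFieldType) r p : admissible r p ->
  \sum_(0 <= n < p) sieve_char R r p n ^+ 2 = p%:R * sieve_weight R r p.
Proof.
move=> ad; rewrite /sieve_char.
transitivity (\sum_(0 <= n < p) (if sieved r p n then 1 else sieve_weight R r p ^+ 2)).
  by apply: eq_bigr => n _; case: ifP => _ //; rewrite sqrrN expr1n.
rewrite sum_if_sieved // /sieve_weight.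
by field; exact: sieve_weight_denom.
Qed.

Lemma prod_norm_le1 (R : realFieldType) (I : eqType) (s : seq I) (F : I -> R) :
  (forall i, i \in s -> `|F i| <= 1) -> `|\prod_(i <- s) F i| <= 1.
Proof.
elim: s => [|i s IH] H; first by rewrite big_nil normr1.
rewrite big_cons normrM mulr_ile1 ?H ?mem_head // IH // => j js.
by rewrite H // inE js orbT.
Qed.

Lemma prod_mem_sublist (R : comNzRingType) (ps l : seq nat) (P : pred nat) (F : nat -> R) :
  uniq ps -> subseq l ps -> {subset l <= P} ->
  \prod_(p <- l) F p = \prod_(p <- ps | P p) (if p \in l then F p else 1).
Proof.
move=> ups sl lP; rewrite {1}(subseq_filter_mem ups sl) big_filter.
rewrite big_mkcond [RHS]big_mkcond /=; apply: eq_bigr => p _.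
by case: ifP => [/lP pP|_]; [rewrite [P p]pP|rewrite if_same].
Qed.

(** The product is a function with period [Q], the product of the primes that
    occur in [l] or [l']. A prime in only one of the lists makes its mean vanish,
    and a common prime contributes the mean square [sieve_weight]. *)
Lemma sieve_orthogonality (R : realFieldType) r (ps l l' : seq nat) (D N : nat) :
  uniq ps -> (forall p, p \in ps -> admissible r p) ->
  subseq l ps -> subseq l' ps ->
  (\prod_(p <- l) p <= D)%N -> (\prod_(p <- l') p <= D)%N ->
  \sum_(0 <= n < N) (\prod_(p <- l) sieve_char R r p n) * (\prod_(p <- l') sieve_char R r p n)
  <= (if l == l' then N%:R * \prod_(p <- l) sieve_weight R r p else 0) + 2 * D%:R ^+ 2.
Proof.
move=> ups ad sl sl' lD lD'.
pose P p := (p \in l) || (p \in l').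
pose c p n := sieve_char R r p n.
pose e p n := (if p \in l then c p n else 1) * (if p \in l' then c p n else 1).
pose U := [seq p <- ps | P p].
have Ups : {subset U <= ps} by apply: mem_subseq; apply: filter_subseq.
have uU : uniq U by apply: filter_uniq.
have aU : all prime U by apply/allP => p /Ups /ad [].
have pe p : periodic p (e p) by move=> n; rewrite /e /c !sieve_char_periodic.
have ec n : (\prod_(p <- l) c p n) * (\prod_(p <- l') c p n) = \prod_(p <- U) e p n.
  rewrite (@prod_mem_sublist _ ps l P) // => [|p pl]; last by rewrite unfold_in /P pl.
  rewrite (@prod_mem_sublist _ ps l' P) // => [|p pl]; last by rewrite unfold_in /P pl orbT.
  by rewrite -big_split big_filter.
rewrite [leLHS](eq_bigr _ (fun n _ => ec n)).
set Q := (\prod_(p <- U) p)%N.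
have Q0 : (0 < Q)%N.
  by rewrite /Q big_seq prodn_cond_gt0 // => p /(allP aU) /prime_gt0.
have QD : Q%:R <= D%:R ^+ 2 :> R.
  rewrite -natrX ler_nat expnS expn1; apply: leq_trans (leq_mul lD lD').
  rewrite /Q {1}(subseq_filter_mem ups sl) {1}(subseq_filter_mem ups sl') !big_filter.
  rewrite big_mkcond [X in (_ <= X * _)%N]big_mkcond [X in (_ <= _ * X)%N]big_mkcond.
  rewrite -big_split /= !big_seq; apply: leq_prod => p pps.
  have p0 : (0 < p)%N by have [/prime_gt0] := ad p pps.
  by rewrite /P; do 2!case: (p \in _) => //=; nia.
have b1 n : `|\prod_(p <- U) e p n| <= 1.
  apply: prod_norm_le1 => p /Ups /ad adp.
  have := sieve_char_bound R n adp; rewrite /e -/(c p n) => cb.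
  rewrite normrM -[leRHS]mulr1; apply: ler_pM => //; by case: ifP; rewrite // normr1.
have pQ : periodic Q (fun n => \prod_(p <- U) e p n).
  move=> n; apply: eq_big_seq => p pU.
  have /dvdnP[k ->] : (p %| Q)%N by rewrite /Q (perm_big _ (perm_to_rem pU)) big_cons dvdn_mulr.
  by rewrite addnC periodic_addM.
apply: le_trans (sum_periodic_le N Q0 pQ b1) _.
apply: lerD; last by rewrite ler_pM2l.
rewrite sum_prod_periodic //.
have [ll|ll] := eqVneq l l'.
  have Ul : U = l.
    rewrite [RHS](subseq_filter_mem ups sl); apply: eq_filter => p.
    by rewrite /P -ll orbb.
  have -> : \prod_(p <- U) \sum_(0 <= n < p) e p n
      = Q%:R * \prod_(p <- l) sieve_weight R r p.
    rewrite /Q natr_prod Ul -big_split /=; apply: eq_big_seq => p pl.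
    rewrite -sum_sieve_char_sqr; last by apply: ad; apply: mem_subseq sl _ pl.
    by apply: eq_bigr => n _; rewrite /e -ll pl expr2.
  by rewrite mulrA divfK // pnatr_eq0 -lt0n.
suff /hasP[p pps pll] : has (fun p => (p \in l) != (p \in l')) ps.
  have pU : p \in U by rewrite mem_filter pps andbT /P; move: pll; do 2!case: (p \in _).
  rewrite (perm_big _ (perm_to_rem pU)) big_cons.
  have -> : \sum_(0 <= n < p) e p n = 0.
    apply: etrans (sum_sieve_char R (ad p pps)); apply: eq_bigr => n _.
    by rewrite /e; move: pll; do 2!case: (p \in _); rewrite ?mulr1 ?mul1r.
  by rewrite /= mul0r mulr0.
apply: contraNT ll => /hasPn H.
rewrite (subseq_filter_mem ups sl) (subseq_filter_mem ups sl').
by apply/eqP/eq_in_filter => p /H; rewrite negbK => /eqP.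
Qed.

Lemma sieve_sum_ge0 (R : realFieldType) r (ps : seq nat) (x : nat) :
  (forall p, p \in ps -> admissible r p) -> 0 <= sieve_sum R r ps x.
Proof.
move=> ad; have aps : all prime ps by apply/allP => p /ad[].
rewrite /sieve_sum big_seq; apply: sumr_ge0 => l /(mem_sublists_le aps)[/mem_subseq sl _].
rewrite big_seq; apply: prodr_ge0 => p /sl /ad /(sieve_weight_bound R) /andP[] //.
Qed.

Lemma sieve_sum_ge1 (R : realFieldType) r (ps : seq nat) (x : nat) :
  (forall p, p \in ps -> admissible r p) -> (0 < x)%N -> 1 <= sieve_sum R r ps x.
Proof.
move=> + x0; elim: ps => [|p ps IH] ad.
  by rewrite /sieve_sum /= x0 big_seq1 big_nil.
have ad' q : q \in ps -> admissible r q by move=> qs; apply: ad; rewrite inE qs orbT.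
rewrite /sieve_sum /= big_cat big_map /=.
under [X in _ + X]eq_bigr do rewrite big_cons.
rewrite -mulr_sumr -!/(sieve_sum _ _ _ _).
have /andP[g0 _] := sieve_weight_bound R (ad p (mem_head _ _)).
by rewrite -[leLHS]addr0; apply: lerD; [exact: IH|rewrite mulr_ge0 ?sieve_sum_ge0].
Qed.

(** Selberg's upper bound. The function [W] below equals [sieve_sum] on the
    unsieved integers, and by orthogonality its mean square is [sieve_sum]. *)
Theorem selberg_sieve (R : realFieldType) r (ps : seq nat) (D N : nat) :
  uniq ps -> (forall p, p \in ps -> admissible r p) -> (0 < D)%N ->
  (count (fun n => all (fun p => ~~ sieved r p n) ps) (iota 0 N))%:R
  <= N%:R / sieve_sum R r ps D + 2 * D%:R ^+ 4.
Proof.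
move=> ups ad D0; have aps : all prime ps by apply/allP => p /ad[].
have G1 := sieve_sum_ge1 R ad D0; set G := sieve_sum R r ps D in G1 *.
set L := sublists_le ps D.
pose W n := \sum_(l <- L) \prod_(p <- l) sieve_char R r p n.
set S := (count _ _)%:R.
have WG n : all (fun p => ~~ sieved r p n) ps -> W n = G.
  move=> /allP H; apply: eq_big_seq => l /(mem_sublists_le aps)[/mem_subseq sl _].
  by apply: eq_big_seq => p /sl /H; rewrite /sieve_char => /negbTE ->.
have up : \sum_(0 <= n < N) W n ^+ 2 <= N%:R * G + 2 * D%:R ^+ 4.
  have -> : \sum_(0 <= n < N) W n ^+ 2 = \sum_(l <- L) \sum_(l' <- L) \sum_(0 <= n < N)
      (\prod_(p <- l) sieve_char R r p n) * (\prod_(p <- l') sieve_char R r p n).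
    under [RHS]eq_bigr do rewrite exchange_big /=.
    rewrite [RHS]exchange_big /=; apply: eq_bigr => n _.
    rewrite expr2 /W mulr_suml; apply: eq_bigr => l _.
    by rewrite mulr_sumr.
  apply: (@le_trans _ _ (\sum_(l <- L) \sum_(l' <- L)
     ((if l == l' then N%:R * \prod_(p <- l) sieve_weight R r p else 0) + 2 * D%:R ^+ 2))).
    rewrite big_seq [leRHS]big_seq; apply: ler_sum => l lL.
    rewrite big_seq [leRHS]big_seq; apply: ler_sum => l' lL'.
    have [sl lD] := mem_sublists_le aps lL; have [sl' lD'] := mem_sublists_le aps lL'.
    exact: (sieve_orthogonality R N ups ad sl sl' lD lD').
  under eq_bigr do rewrite big_split /=.
  rewrite big_split /=; apply: lerD.
    rewrite mulr_sumr big_seq [leRHS]big_seq; apply: ler_sum => l lL.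
    rewrite -big_mkcond big_const_seq /= (eq_count (a2 := pred1 l)); last by move=> k; rewrite /= eq_sym.
    by rewrite count_uniq_mem ?uniq_sublists_le // lL /= addr0.
  rewrite !big_const_seq !iter_addr_0 !count_predT -mulrnA.
  rewrite -[leLHS]mulr_natr natrM.
  rewrite [2 * _ ^+ 4](_ : _ = 2 * D%:R ^+ 2 * (D%:R * D%:R)); last by ring.
  apply: ler_wpM2l; first by rewrite mulr_ge0 ?exprn_ge0.
  by apply: ler_pM; rewrite // ler_nat size_sublists_le.
have G0 : 0 < G by lra.
have D4 : 0 <= D%:R ^+ 4 :> R by rewrite exprn_ge0.
have low : S * G ^+ 2 <= \sum_(0 <= n < N) W n ^+ 2.
  rewrite /S -sum1_count natr_sum mulr_suml /index_iota subn0.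
  rewrite big_mkcond /=; apply: ler_sum => n _.
  by case: ifP => [/WG ->|_]; rewrite ?mul1r ?sqr_ge0.
have {low up} H := le_trans low up.
rewrite -(ler_pM2r (exprn_gt0 2 G0)); apply: (le_trans H).
rewrite [leRHS]mulrDl; apply: lerD.
  by rewrite expr2 mulrA divfK ?gt_eqF.
by rewrite ler_peMr ?mulr_ge0 // expr_ge1 // ltW.
Qed.

(** * The main term of the sieve *)

Lemma ler_sum_inj (R : numDomainType) (I J : eqType) (s : seq I) (t : seq J)
    (f : I -> J) (F : J -> R) :
  uniq s -> {in s &, injective f} -> (forall i, i \in s -> f i \in t) ->
  (forall j, j \in t -> 0 <= F j) ->
  \sum_(i <- s) F (f i) <= \sum_(j <- t) F j.
Proof.
move=> us injf ft; rewrite -(big_map f xpredT F).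
have : uniq (map f s) by rewrite map_inj_in_uniq.
have : {subset map f s <= t} by move=> j /mapP[i /ft + ->].
elim: (map f s) t {ft} => [|j u IH] t ut /=.
  by move=> _ F0; rewrite big_nil big_seq sumr_ge0.
move=> /andP[ju uu] F0.
have jt : j \in t by apply: ut; rewrite mem_head.
rewrite big_cons (perm_big _ (perm_to_rem jt)) big_cons /= lerD2l.
apply: IH => // [k ku|k /mem_rem]; last exact: F0.
have kt : k \in t by apply: ut; rewrite inE ku orbT.
move: kt; rewrite (perm_mem (perm_to_rem jt)) inE => /orP[/eqP kj|//].
by rewrite -kj ku in ju.
Qed.

Definition smooth_sum (R : realFieldType) (ps : seq nat) (x : nat) : R :=
  \sum_(1 <= n < x.+1 | all (mem ps) (primes n)) n%:R^-1.

Lemma smooth_sum_ge0 (R : realFieldType) ps x : 0 <= smooth_sum R ps x.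
Proof. by apply: sumr_ge0 => n _; rewrite invr_ge0. Qed.

Lemma smooth_sum_mono (R : realFieldType) ps x y : (x <= y)%N ->
  smooth_sum R ps x <= smooth_sum R ps y.
Proof.
move=> xy; rewrite /smooth_sum [leRHS](@big_cat_nat _ _ _ x.+1) //=.
by rewrite lerDl; apply: sumr_ge0 => n _; rewrite invr_ge0.
Qed.

(** The terms divisible by [p] are [p * m] with [m <= x %/ p]. *)
Lemma smooth_sum_cons (R : realFieldType) p ps x : prime p ->
  smooth_sum R (p :: ps) x
  <= smooth_sum R ps x + p%:R^-1 * smooth_sum R (p :: ps) (x %/ p).
Proof.
move=> pp; have p0 := prime_gt0 pp.
rewrite {1}/smooth_sum (bigID (fun n => p %| n)%N) /= addrC; apply: lerD.
  rewrite /smooth_sum big_mkcond [leRHS]big_mkcond /= big_nat [leRHS]big_nat.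
  apply: ler_sum => n /andP[n0 _].
  have := ler0n R n; rewrite -invr_ge0 => n1.
  case: ifP => [/andP[/allP H pn]|_]; case: ifP => // /negP[]; apply/allP => q qn.
  move: (H q qn); rewrite inE => /orP[/eqP qp|//].
  by move: qn pn; rewrite qp mem_primes => /and3P[_ _ ->].
rewrite /smooth_sum mulr_sumr -big_filter -[leRHS]big_filter.
set s := filter _ _; set t := filter _ (index_iota 1 _).
have -> : \sum_(n <- s) n%:R^-1 = \sum_(n <- s) p%:R^-1 * (n %/ p)%:R^-1 :> R.
  apply: eq_big_seq => n; rewrite mem_filter mem_index_iota => /andP[/andP[_ /dvdnP[k ->]] /andP[n0 _]].
  by rewrite mulnK // natrM invfM mulrC.
apply: (ler_sum_inj (f := fun n => (n %/ p)%N) (F := fun n => p%:R^-1 * n%:R^-1)).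
- exact/filter_uniq/iota_uniq.
- move=> m n; rewrite !mem_filter => /andP[/andP[_ pm] _] /andP[/andP[_ pn] _] e.
  by rewrite -(divnK pm) e divnK.
- move=> n; rewrite !mem_filter !mem_index_iota => /andP[/andP[H /dvdnP[k nE]] /andP[n0 nx]].
  move: H n0 nx; rewrite nE mulnK // !ltnS muln_gt0 => H /andP[k0 _] kx.
  rewrite k0 leq_divRL // kx !andbT.
  by apply/allP => q qk; apply: (allP H); rewrite primesM // qk.
- by move=> n _; rewrite -invfM invr_ge0 mulr_ge0.
Qed.

(** Iterating the previous recursion sums the geometric series of [1 / p]. *)
Lemma smooth_sum_cons_le (R : realFieldType) p ps x : prime p ->
  smooth_sum R (p :: ps) x
  <= smooth_sum R ps x + (p%:R - 1)^-1 * smooth_sum R ps (x %/ p).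
Proof.
move=> pp; have p1 := prime_gt1 pp.
have pr : 1 < p%:R :> R by rewrite ltr1n.
have [k] := ubnP x; elim: k x => // k IH x; rewrite ltnS => xk.
case: x xk => [|x] xk.
  by rewrite div0n {1}/smooth_sum big_geq // addr_ge0 ?mulr_ge0 ?smooth_sum_ge0 // invr_ge0; lra.
apply: le_trans (smooth_sum_cons R ps x.+1 pp) _; rewrite lerD2l.
have xp : (x.+1 %/ p < k)%N by apply: leq_trans xk; rewrite ltn_Pdiv.
have h1 : smooth_sum R ps (x.+1 %/ p %/ p) <= smooth_sum R ps (x.+1 %/ p).
  by apply: smooth_sum_mono; rewrite leq_div.
have t0 : 0 < (p%:R - 1)^-1 :> R by rewrite invr_gt0; lra.
have := IH _ xp; have := smooth_sum_ge0 R ps (x.+1 %/ p).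
set H' := smooth_sum R ps _ in h1 *; set H := smooth_sum R ps _ in h1 *.
set K := smooth_sum R _ _ => H0 HK.
apply: (@le_trans _ _ (p%:R^-1 * (H + (p%:R - 1)^-1 * H))).
  rewrite ler_pM2l ?invr_gt0 ?ltr0n ?prime_gt0 //; apply: le_trans HK _.
  by rewrite lerD2l ler_pM2l.
rewrite -[X in _ * (X + _)]mul1r -mulrDl mulrA; apply: ler_wpM2r => //.
rewrite le_eqVlt; apply/orP; left; apply/eqP; field.
by rewrite !gt_eqF ?subr_gt0 // lt_neqAle; lra.
Qed.

Lemma sieve_sum_cons (R : realFieldType) r p ps x :
  sieve_sum R r (p :: ps) x
  = sieve_sum R r ps x + sieve_weight R r p * sieve_sum R r ps (x %/ p).
Proof.
rewrite /sieve_sum /= big_cat big_map /= mulr_sumr; congr (_ + _).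
by apply: eq_bigr => l _; rewrite big_cons.
Qed.

Lemma sieve_sum_mono (R : realFieldType) r ps x y :
  (forall p, p \in ps -> admissible r p) -> (x <= y)%N ->
  sieve_sum R r ps x <= sieve_sum R r ps y.
Proof.
elim: ps x y => [|p ps IH] x y ad xy.
  case: x xy => [|x] xy; last by rewrite /sieve_sum /= (leq_trans _ xy).
  by rewrite /sieve_sum /=; case: ifP; rewrite ?big_nil ?big_seq1 ?big_nil.
have ad' q : q \in ps -> admissible r q by move=> qs; apply: ad; rewrite inE qs orbT.
have /andP[g0 _] := sieve_weight_bound R (ad p (mem_head _ _)).
rewrite !sieve_sum_cons; apply: lerD; first exact: IH.
by apply: ler_wpM2l => //; apply: IH => //; apply: leq_div2r.
Qed.

Definition sieve_singular (R : realFieldType) (r : nat -> nat) (ps : seq nat) : R :=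
  \prod_(p <- ps | r p == 0%N) (p%:R / (p%:R - 1)).

(** By [smooth_sum_cons_le], adjoining [p] to both factors on the left brings in
    terms with total coefficient [2 t + t ^ 2], where [t = 1 / (p - 1)]. If two
    classes are sieved, this is at most the weight [2 / (p - 2)]. If only the class
    of 0 is sieved, the weight is [t], and the factor [1 + t] of [sieve_singular]
    supplies the rest: [(1 + t) * (1 + t) = 1 + (2 t + t ^ 2)]. *)
Lemma smooth_sum_mul_le (R : realFieldType) r ps x y :
  (forall p, p \in ps -> admissible r p) ->
  smooth_sum R ps x * smooth_sum R ps y
  <= sieve_singular R r ps * sieve_sum R r ps (x * y).
Proof.
elim: ps x y => [|p ps IH] x y ad.
  rewrite /sieve_singular big_nil mul1r.
  have H z : smooth_sum R [::] z = (0 < z)%N%:R.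
    rewrite /smooth_sum; case: z => [|z]; first by rewrite big_geq.
    rewrite big_mkcond big_nat_recl //= invr1 big_nat big1 ?addr0 // => n /andP[n0 _].
    have : primes n.+1 != [::] by rewrite primes_eq0; lia.
    by case: (primes n.+1).
  rewrite !H /sieve_sum /= muln_gt0; do 2!case: (0 < _)%N;
    by rewrite /= ?big_nil ?big_seq1 ?big_nil ?mulr1 ?mulr0 ?mul0r.
have ad' q : q \in ps -> admissible r q by move=> qs; apply: ad; rewrite inE qs orbT.
have adp := ad p (mem_head _ _); have [pp [_ r4]] := adp.
have p1 := prime_gt1 pp.
have pr : 2 <= p%:R :> R by rewrite ler_nat.
set t : R := (p%:R - 1)^-1; have t0 : 0 < t by rewrite /t invr_gt0; lra.
set F := sieve_singular R r ps.
have F0 : 0 <= F.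
  rewrite /F /sieve_singular big_seq_cond; apply: prodr_ge0 => q /andP[/ad'[/prime_gt1 q1 _] _].
  by rewrite divr_ge0 // subr_ge0 ler1n ltnW.
set G := sieve_sum R r ps (x * y); set G' := sieve_sum R r ps (x * y %/ p).
have GG : F * G' <= F * G by apply: ler_wpM2l => //; apply: sieve_sum_mono => //; exact: leq_div.
have G0 : 0 <= F * G' by apply: mulr_ge0 => //; apply: sieve_sum_ge0.
have mono z : (z <= x * y %/ p)%N -> F * sieve_sum R r ps z <= F * G'.
  by move=> zz; apply: ler_wpM2l => //; apply: sieve_sum_mono.
have A1 := smooth_sum_cons_le R ps x pp; have A2 := smooth_sum_cons_le R ps y pp.
have B1 := IH x y ad'.
have B2 : smooth_sum R ps x * smooth_sum R ps (y %/ p) <= F * G'.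
  apply: le_trans (IH _ _ ad') _; apply: mono.
  by rewrite leq_divRL ?prime_gt0 // -mulnA leq_mul // leq_trunc_div.
have B3 : smooth_sum R ps (x %/ p) * smooth_sum R ps y <= F * G'.
  apply: le_trans (IH _ _ ad') _; apply: mono.
  by rewrite leq_divRL ?prime_gt0 // mulnAC leq_mul // leq_trunc_div.
have B4 : smooth_sum R ps (x %/ p) * smooth_sum R ps (y %/ p) <= F * G'.
  apply: le_trans B3; apply: ler_wpM2l; first exact: smooth_sum_ge0.
  by apply: smooth_sum_mono; rewrite leq_div.
have U : smooth_sum R (p :: ps) x * smooth_sum R (p :: ps) y <= F * G + (2 * t + t ^+ 2) * (F * G').
  apply: le_trans (ler_pM (smooth_sum_ge0 _ _ _) (smooth_sum_ge0 _ _ _) A1 A2) _.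
  move: B1 B2 B3 B4; rewrite -/t -/F -/G.
  set a := smooth_sum _ _ x; set b := smooth_sum _ _ y.
  set a' := smooth_sum _ _ (x %/ p); set b' := smooth_sum _ _ (y %/ p) => B1 B2 B3 B4.
  have -> : (a + t * a') * (b + t * b') = a * b + t * (a * b') + t * (a' * b) + t ^+ 2 * (a' * b') by ring.
  have C2 : t * (a * b') <= t * (F * G') by rewrite ler_pM2l.
  have C3 : t * (a' * b) <= t * (F * G') by rewrite ler_pM2l.
  have C4 : t ^+ 2 * (a' * b') <= t ^+ 2 * (F * G') by rewrite ler_pM2l // exprn_gt0.
  lra.
apply: le_trans U _; rewrite sieve_sum_cons -/G -/G' /sieve_singular big_cons -/(sieve_singular R r ps) -/F.
rewrite /sieve_weight /num_sieved; case: (r p =P 0%N) => [r0|/eqP r0] /=.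
  have -> : p%:R / (p%:R - 1) = 1 + t by rewrite /t; field; lra.
  rewrite -/t mul1r.
  have -> : (1 + t) * F * (G + t * G') = F * G + t * (F * G) + (t + t ^+ 2) * (F * G') by ring.
  have : t * (F * G') <= t * (F * G) by rewrite ler_pM2l.
  lra.
have p4 : 4 <= p%:R :> R by rewrite ler_nat r4.
rewrite mulrDr lerD2l [leRHS]mulrCA; apply: ler_wpM2r => //.
rewrite /t -subr_ge0.
have -> : 2 / (p%:R - 2) - (2 * (p%:R - 1)^-1 + (p%:R - 1)^-1 ^+ 2)
   = p%:R / ((p%:R - 2) * (p%:R - 1) ^+ 2) :> R by field; lra.
by apply: divr_ge0; [lra|apply: mulr_ge0; [lra|exact: sqr_ge0]].
Qed.

Lemma ln_le_harmonic (R : realType) (n : nat) :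
  ln n.+1%:R <= \sum_(1 <= m < n.+1) m%:R^-1 :> R.
Proof.
elim: n => [|n IH]; first by rewrite ln1 big_geq.
rewrite big_nat_recr //= -lerBlDr; apply: le_trans IH.
rewrite lerBlDr -lerBlDl -ln_div ?posrE ?ltr0n //.
have -> : n.+2%:R / n.+1%:R = 1 + n.+1%:R^-1 :> R.
  by rewrite -natr1 mulrDl mulfV ?mul1r // pnatr_eq0.
by apply: le_ln1Dx; rewrite (lt_trans (ltrN10 _)) // invr_gt0 ltr0n.
Qed.

Definition primes_upto (n : nat) : seq nat := [seq p <- iota 0 n.+1 | prime p].

Lemma mem_primes_upto n p : (p \in primes_upto n) = prime p && (p <= n)%N.
Proof. by rewrite mem_filter mem_iota add0n ltnS. Qed.

(** All integers up to [d] are smooth over the primes up to [d ^ 2], so that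
    [smooth_sum] is here the harmonic sum. *)
Lemma sieve_sum_ge (R : realType) r (d : nat) :
  (forall p, prime p -> admissible r p) ->
  ln d.+1%:R ^+ 2 <= sieve_singular R r (primes_upto (d ^ 2)) *
                     sieve_sum R r (primes_upto (d ^ 2)) (d ^ 2).
Proof.
move=> ad; set ps := primes_upto _.
have adp p : p \in ps -> admissible r p by rewrite mem_filter => /andP[/ad].
have := smooth_sum_mul_le R d d adp; rewrite -[(d * d)%N]/(d ^ 2)%N; apply: le_trans.
suff H : ln d.+1%:R <= smooth_sum R ps d :> R.
  by rewrite expr2; apply: ler_pM => //; exact: ln_nat_ge0.
apply: le_trans (ln_le_harmonic _ _) _.
rewrite /smooth_sum [leRHS]big_mkcond; apply: ler_sum_nat => n /andP[n0 nd].
rewrite ifT //; apply/allP => q; rewrite mem_primes => /and3P[pq _ /dvdn_leq qn].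
have d1 : (d <= d ^ 2)%N by rewrite -{1}(expn1 d) leq_pexp2l //; lia.
rewrite /= mem_primes_upto pq /=.
by apply: leq_trans (qn n0) _; apply: leq_trans d1.
Qed.

(** * Shifted primes with a given cofactor *)

Definition totient_ratio (R : realFieldType) (n : nat) : R := n%:R / (totient n)%:R.

Lemma totient_ratioE (R : realFieldType) (n : nat) : (0 < n)%N ->
  totient_ratio R n = \prod_(p <- primes n) (p%:R / (p%:R - 1)).
Proof.
move=> n0; rewrite /totient_ratio {1}(prod_prime_decomp n0) prime_decompE big_map /=.
rewrite totientE // !natr_prod -prodf_div; apply: eq_big_seq => p.
rewrite mem_primes => /and3P[pp _ pn].
have p1 := prime_gt1 pp.
have l0 : (0 < logn p n)%N by rewrite logn_gt0 mem_primes pp n0.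
have pr : 1 < p%:R :> R by rewrite ltr1n.
rewrite -(prednK l0) expnS !natrM -[in X in X * _ / _](prednK (ltnW p1)).
have -> : p.-1%:R = p%:R - 1 :> R by rewrite -subn1 natrB // ltnW.
have X0 : (p ^ (logn p n).-1)%N%:R != 0 :> R by rewrite pnatr_eq0 -lt0n expn_gt0 ltnW.
rewrite prednK ?(ltnW p1) //= -mulf_div divff // mulr1 //.
Qed.

Lemma prime_ratio_ge1 (R : realFieldType) (p : nat) : prime p ->
  1 <= p%:R / (p%:R - 1) :> R.
Proof.
move=> /prime_gt1 p1; have pr : 1 < p%:R :> R by rewrite ltr1n.
by rewrite ler_pdivlMr; lra.
Qed.

Lemma totient_ratio_ge1 (R : realFieldType) (n : nat) : (0 < n)%N -> 1 <= totient_ratio R n.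
Proof.
move=> n0; rewrite totient_ratioE // big_seq; elim/big_rec: _ => // p x.
by rewrite mem_primes => /andP[/(prime_ratio_ge1 R) p1 _] x1; rewrite mulr_ege1.
Qed.

Lemma prod_mem_le (R : realFieldType) (ps s : seq nat) (f : nat -> R) :
  uniq ps -> uniq s -> (forall p, p \in s -> 1 <= f p) ->
  \prod_(p <- ps | p \in s) f p <= \prod_(p <- s) f p.
Proof.
move=> ups us f1; rewrite -big_filter.
have pe : perm_eq [seq p <- ps | p \in s] [seq p <- s | p \in ps].
  apply: uniq_perm; rewrite ?filter_uniq // => p; rewrite !mem_filter; exact: andbC.
rewrite (perm_big _ pe) big_filter big_mkcond /= big_seq [leRHS]big_seq.
apply: ler_prod => p ps'; have := f1 p ps'.
by case: ifP => _ H; rewrite ?lexx ?ler01 ?H // ?andbT; lra.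
Qed.

(** The constant 3 is the product of the Euler factors 2 and 3/2 at 2 and 3. *)
Lemma sieve_singular_le (R : realFieldType) r (ps : seq nat) (a h : nat) :
  (0 < a)%N -> (0 < h)%N -> uniq ps -> all prime ps ->
  (forall p, p \in ps -> r p = 0%N -> p %| 6 * a * h)%N ->
  sieve_singular R r ps <= 3 * totient_ratio R a * totient_ratio R h.
Proof.
move=> a0 h0 ups aps H.
pose f (p : nat) : R := p%:R / (p%:R - 1).
have -> : 3 = \prod_(p <- [:: 2; 3]%N) f p by rewrite !big_cons big_nil /f; field.
rewrite !totient_ratioE // -!/(f _).
have f1 n p : p \in primes n -> 1 <= f p.
  by rewrite mem_primes => /andP[/(prime_ratio_ge1 R)].
have f1' p : p \in [:: 2; 3]%N -> 1 <= f p.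
  by rewrite !inE => /orP[] /eqP ->; apply: prime_ratio_ge1.
have b1 := prod_mem_le ups (isT : uniq [:: 2; 3]%N) f1'.
have b2 := prod_mem_le ups (primes_uniq a) (f1 a).
have b3 := prod_mem_le ups (primes_uniq h) (f1 h).
have ge0 (P : pred nat) : 0 <= \prod_(p <- ps | P p) f p.
  rewrite big_seq_cond; apply: prodr_ge0 => p /andP[/(allP aps) /(prime_ratio_ge1 R)].
  by rewrite -/(f p) => ? _; lra.
apply: le_trans (ler_pM (mulr_ge0 (ge0 _) (ge0 _)) (ge0 _) (ler_pM (ge0 _) (ge0 _) b1 b2) b3).
rewrite /sieve_singular big_mkcond [X in X * _ * _]big_mkcond [X in _ * X * _]big_mkcond.
rewrite [X in _ * _ * X]big_mkcond -!big_split /= big_seq [leRHS]big_seq.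
apply: ler_prod => p pps; have pp := allP aps p pps.
have p1 := prime_ratio_ge1 R pp; rewrite -/(f p) in p1 *.
have m1 (b : bool) : 1 <= (if b then f p else 1) by case: b.
case: (r p =P 0%N) => [r0|_]; last first.
  by rewrite ler01 /=; apply: mulr_ege1 (mulr_ege1 (m1 _) (m1 _)) (m1 _).
apply/andP; split; first lra.
have p2 : f p <= f p * f p by rewrite ler_peMl //; lra.
have p3 : f p * f p <= f p * f p * f p by rewrite ler_peMr //; lra.
have := H p pps r0; rewrite !Euclid_dvdM // -[6%N]/(2 * 3)%N Euclid_dvdM //.
rewrite (@dvdn_prime2 p 2) // (@dvdn_prime2 p 3) //.
rewrite !mem_primes pp a0 h0 /= !inE.
move: (p == 2%N) (p == 3%N) (p %| a)%N (p %| h)%N => b2' b3' ba bh.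
by case: b2'; case: b3'; case: ba; case: bh => //= _; rewrite ?mulr1 ?mul1r //; lra.
Qed.

Lemma linear_congruence (p A : nat) (a : int) : prime p -> ~~ (p %| A)%N ->
  exists2 j, (j < p)%N & (p%:Z %| (A * j)%N%:Z - a)%Z.
Proof.
move=> pp pA; have p0 := prime_gt0 pp.
have /coprimezP [[u v] /= uv] : coprimez A%:Z p%:Z.
  by rewrite coprimezE /= coprime_sym prime_coprime.
have pz : 0 < p%:Z by rewrite ltz_nat.
have m0 : 0 <= ((u * a) %% p%:Z)%Z by rewrite modz_ge0 // gt_eqF.
exists `|((u * a) %% p%:Z)%Z|%N.
  by rewrite -ltz_nat gez0_abs // ltz_pmod.
rewrite PoszM gez0_abs //.
apply/dvdzP; exists (- a * v - A%:Z * ((u * a) %/ p%:Z)%Z).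
have := divz_eq (u * a) p%:Z.
set m := modz _ _; set q := divz _ _ => E.
have -> : m = u * a - q * p%:Z by rewrite E; ring.
have -> : A%:Z * (u * a - q * p%:Z) - a = (u * A%:Z + v * p%:Z - 1) * a - a * v * p%:Z - A%:Z * q * p%:Z by ring.
rewrite uv; ring.
Qed.

(** The nonzero class of [n] modulo [p] for which [p] divides [A * n - a], where
    [A] is [s * h]. At the divisors of [a] or [h] there is no unique such class; at
    2 and 3 a second class would make the weight infinite or larger than 1. In all
    these cases only 0 is sieved. *)
Definition sieve_residue (a : int) (A h p : nat) : nat :=
  if (p %| 6 * `|a| * h)%N then 0%N
  else find (fun j => (p%:Z %| (A * j)%N%:Z - a)%Z) (iota 0 p).

Section Fiber.
Variables (a : int) (s h : nat).
Hypothesis (s12 : (0 < s <= 2)%N).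
Local Notation A := (s * h)%N.
Local Notation r := (sieve_residue a A h).

Lemma sieve_residueP p : prime p -> ~~ (p %| 6 * `|a| * h)%N ->
  [/\ (r p < p)%N, r p != 0%N & (p%:Z %| (A * r p)%N%:Z - a)%Z].
Proof.
move=> pp pE; rewrite /sieve_residue (negbTE pE).
set P := fun j => _; set f := find _ _.
move: pE; rewrite !Euclid_dvdM // !negb_or => /andP[/andP[p6 pa] ph].
have pA : ~~ (p %| A)%N.
  rewrite Euclid_dvdM // negb_or ph andbT.
  apply: contra p6 => /dvdn_leq; case: s s12 => [|[|[|//]]] // _ p2.
    by have := p2 isT; have := prime_gt1 pp; lia.
  by have -> : p = 2%N by have := p2 isT; have := prime_gt1 pp; lia.
have hP : has P (iota 0 p).
  by have [j jp Pj] := linear_congruence a pp pA; apply/hasP; exists j; rewrite ?mem_iota.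
have fp : (f < p)%N by move: hP; rewrite has_find size_iota.
have Pf : P f by have := nth_find 0%N hP; rewrite nth_iota ?add0n.
split=> //; apply: contra pa => /eqP f0.
by move: Pf; rewrite /P f0 muln0 sub0r dvdzE abszN.
Qed.

Lemma sieve_residue_admissible p : prime p -> admissible r p.
Proof.
move=> pp; split=> //; have p1 := prime_gt1 pp.
have [pE|pE] := boolP (p %| 6 * `|a| * h)%N.
  by rewrite /sieve_residue pE; split => //; exact: prime_gt0.
have [rp r0 _] := sieve_residueP pp pE; split => // _.
rewrite leqNgt; apply: contra pE => p4.
have : p = 2%N \/ p = 3%N by lia.
by case=> ->; rewrite -mulnA dvdn_mulr.
Qed.

(** If [n] lies in the second class, then [p] divides the prime [q = s h n - a],
    hence equals it. *)
Lemma not_sieved (n p q : nat) : prime p -> prime q -> p != q ->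
  q%:Z = (A * n)%N%:Z - a -> ~~ (p %| n)%N -> ~~ sieved r p n.
Proof.
move=> pp pq npq qE pn; rewrite /sieved negb_or -[(n %% p == 0)%N]/(p %| n)%N pn /=.
have [pE|pE] := boolP (p %| 6 * `|a| * h)%N.
  by rewrite /sieve_residue pE.
have [rp r0 rA] := sieve_residueP pp pE.
apply: contra npq => /eqP nr.
rewrite -dvdn_prime2 // -[(p %| q)%N]/(p%:Z %| q%:Z)%Z qE.
move: rA; rewrite -nr => /dvdzP[z zE].
apply/dvdzP; exists (z + (A * (n %/ p))%N%:Z).
rewrite {1}(divn_eq n p) mulrDl -zE !(PoszM, PoszD); ring.
Qed.
End Fiber.

Lemma expR_ge_exprn (R : realType) (x : R) (n : nat) : 0 <= x ->
  x ^+ n.+1 / (n.+1)`!%:R <= expR x.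
Proof. by move=> x0; apply: le_trans (expR_ge1Dxn n x0); rewrite lerDr. Qed.

Lemma ln2_bounds (R : realType) : 1 / 2 <= ln 2 :> R /\ ln 2 <= 1 :> R.
Proof.
split; last by have := @le_ln1Dx R 1; rewrite -[1 + 1]/2%:R; apply; lra.
have := @le_ln1Dx R (- (1 / 2)).
have -> : 1 + - (1 / 2) = 2^-1 :> R by field.
rewrite lnV ?posrE // => /(_ _); lra.
Qed.

Section FiberCount.
Variables (a : int) (s h : nat).
Hypotheses (h0 : (0 < h)%N) (s12 : (0 < s <= 2)%N).
Local Notation A := (s * h)%N.

(** The three terms bound, in this order, the unsieved [n], the powers of primes
    up to [D], and the [n] for which the prime [s h n - a] is at most [D]. *)
Lemma fiber_count (t : seq nat) (m D : nat) :
  uniq t ->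
  (forall n, n \in t -> (n <= m)%N) ->
  (forall n, n \in t -> exists q b, prime q /\ n = (q ^ b.+1)%N) ->
  (forall n, n \in t -> exists2 p, prime p & p%:Z = (A * n)%N%:Z - a) ->
  (size t <= count (fun n => all (fun p => ~~ sieved (sieve_residue a A h) p n)
      (primes_upto D)) (iota 0 m.+1)
   + D.+1 * (trunc_log 2 m).+2 + D.+1)%N.
Proof.
move=> ut tm tq tp.
pose v n := `|(A * n)%N%:Z - a|%N.
pose P1 n := [exists q : 'I_D.+1, (q %| n)%N && prime q].
pose P2 n := (v n <= D)%N.
have vE n : n \in t -> prime (v n) /\ (v n)%:Z = (A * n)%N%:Z - a.
  by move=> /tp[p pp pE]; rewrite /v -pE absz_nat.
rewrite -(count_predC P2) addnC; apply: leq_add; last first.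
  rewrite -size_filter -(size_map v) -[leqRHS](size_iota 0); apply: uniq_leq_size.
    rewrite map_inj_in_uniq ?filter_uniq // => i j.
    rewrite !mem_filter => /andP[_ /vE[_ iE]] /andP[_ /vE[_ jE]] vv.
    move: jE; rewrite -vv iE => /(congr1 (fun z => z + a)); rewrite !subrK => -[] /eqP.
    rewrite eqn_mul2l => /orP[|/eqP //]; rewrite muln_eq0; lia.
  by move=> n /mapP[k]; rewrite mem_filter /P2 => /andP[vk _] ->; rewrite mem_iota add0n ltnS.
rewrite -size_filter -(count_predC P1) addnC -!size_filter; apply: leq_add.
  apply: uniq_leq_size; first by rewrite !filter_uniq.
  move=> n; rewrite !mem_filter => /and3P[nP1 nP2 nt].
  rewrite mem_iota add0n /= ltnS tm // andbT; apply/allP => p.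
  rewrite mem_primes_upto => /andP[pp pD].
  have [pv vnE] := vE n nt.
  apply: (not_sieved s12 pp pv) => //.
    by apply/eqP => pvn; move: nP2; rewrite /= /P2 -pvn pD.
  move: nP1; apply: contra => pn; apply/existsP.
  by exists (Ordinal (pD : (p < D.+1)%N)); rewrite /= pn.
pose T := [seq (q ^ b)%N | q <- iota 0 D.+1, b <- iota 0 (trunc_log 2 m).+2].
have <- : size T = (D.+1 * (trunc_log 2 m).+2)%N by rewrite size_allpairs !size_iota.
apply: uniq_leq_size; first by rewrite !filter_uniq.
move=> n; rewrite !mem_filter => /and3P[/existsP[q /andP[qn pq]] _ nt].
have [q' [b [pq' nE]]] := tq n nt.
have qq : nat_of_ord q = q' by apply/eqP; move: qn; rewrite nE Euclid_dvdX // andbT dvdn_prime2.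
apply/allpairsP; exists (nat_of_ord q, b.+1); split; last by rewrite /= qq.
  by rewrite mem_iota add0n ltn_ord.
rewrite mem_iota add0n /= ltnS.
have q2 := prime_gt1 pq'.
have : (2 ^ b.+1 <= m)%N.
  by apply: leq_trans (tm n nt); rewrite nE leq_exp2r.
move=> H; have m0 : (0 < m)%N by apply: leq_trans H; rewrite expn_gt0.
by apply: leq_trans (trunc_log_max _ H) _.
Qed.
End FiberCount.

Lemma expn16_bracket (m : nat) : (0 < m)%N ->
  exists2 d, (0 < d)%N & (d ^ 16 <= m < d.+1 ^ 16)%N.
Proof.
move=> m0; have ex : exists d, (d ^ 16 <= m)%N by exists 0%N.
have bd d : (d ^ 16 <= m)%N -> (d <= m)%N.
  by apply: leq_trans; case: d => // d; rewrite -{1}(expn1 d.+1) leq_pexp2l.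
have [d dm dmax] := ex_maxnP ex bd.
exists d; first by apply: dmax; rewrite exp1n.
rewrite dm /= ltnNge; apply/negP => /dmax; lia.
Qed.

(** The left side is of order at most [M ^ (1 / 2) * ln M]; the exponential
    series of [ln M / 2] compares it with [M / ln M ^ 2]. *)
Lemma sieve_error_le (R : realType) (M : R) (m d : nat) :
  2 <= M -> m%:R <= M -> (0 < d)%N -> (d ^ 16 <= m)%N ->
  2 * ((d ^ 2)%N%:R : R) ^+ 4 + (((d ^ 2).+1 * (trunc_log 2 m).+2 + (d ^ 2).+1)%N)%:R
  <= 256 * (M / ln M ^+ 2).
Proof.
move=> M2 mM d0 dm; have [l1 l2] := ln2_bounds R.
have m0 : (0 < m)%N by apply: leq_trans dm; rewrite expn_gt0 d0.
set u := ln M; have u0 : 0 < u by apply: ln_gt0; lra.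
(* [e] is the square root of [M] *)
set e := expR (u / 2).
have e0 : 0 < e by apply: expR_gt0.
have eM : e * e = M.
  rewrite -expRD; have -> : u / 2 + u / 2 = u by field.
  by rewrite lnK // posrE; lra.
have de : (d ^ 8)%N%:R <= e.
  rewrite -(@ler_pXn2r _ 2) ?nnegrE ?ler0n ?(ltW e0) // -natrX -expnM [leRHS]expr2 eM.
  by apply: le_trans mM; rewrite ler_nat.
have De : (d ^ 2)%N%:R <= e by apply: le_trans de; rewrite ler_nat leq_pexp2l.
have D1 : 1 <= (d ^ 2)%N%:R :> R by rewrite ler1n expn_gt0 d0.
have Bu : (trunc_log 2 m)%:R <= 2 * u.
  have H : (trunc_log 2 m)%:R * ln 2 <= u.
    rewrite mulr_natl -lnXn // ler_ln ?posrE ?exprn_gt0 //; last lra.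
    by apply: le_trans mM; rewrite -natrX ler_nat; apply: trunc_logP.
  have : (trunc_log 2 m)%:R * (1 / 2) <= (trunc_log 2 m)%:R * ln 2 :> R by apply: ler_wpM2l.
  lra.
have -> : ((d ^ 2)%N%:R : R) ^+ 4 = (d ^ 8)%N%:R by rewrite -natrX -expnM.
rewrite natrD natrM -!natr1.
set D := (d ^ 2)%N%:R in De D1 *; set B := (trunc_log 2 m)%:R in Bu *.
have B0 : 0 <= B by apply: ler0n.
have u2 : 0 < u ^+ 2 by apply: exprn_gt0.
have e2 : e <= 8 * (M / u ^+ 2).
  rewrite mulrA ler_pdivlMr // -eM.
  have := @expR_ge_exprn R (u / 2) 1 (ltW (divr_gt0 u0 (ltr0n _ 2))).
  rewrite -/e (_ : 2`! = 2)%N // => H; have : u ^+ 2 <= 8 * e.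
    by apply: le_trans (ler_wpM2l _ H); rewrite ?ler0n // /= [leRHS](_ : _ = u ^+ 2) //; field.
  by move=> H2; rewrite [leRHS](_ : _ = e * (8 * e)) ?ler_pM2l //; ring.
have e3 : e * u <= 48 * (M / u ^+ 2).
  rewrite mulrA ler_pdivlMr // -eM.
  have := @expR_ge_exprn R (u / 2) 2 (ltW (divr_gt0 u0 (ltr0n _ 2))).
  rewrite -/e (_ : 3`! = 6)%N // => H; have : u ^+ 3 <= 48 * e.
    by apply: le_trans (ler_wpM2l _ H); rewrite ?ler0n // /= [leRHS](_ : _ = u ^+ 3) //; field.
  move=> H2; rewrite [leRHS](_ : _ = e * (48 * e)); last by ring.
  by rewrite [leLHS](_ : _ = e * u ^+ 3) ?ler_pM2l //; ring.
have : (D + 1) * (B + 3) <= (2 * e) * (2 * u + 3).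
  by apply: ler_pM; lra.
nra.
Qed.

(** The level is [D = d ^ 2] with [d] about [M ^ (1 / 16)], which makes the error
    [D ^ 4] of the sieve at most [M ^ (1 / 2)]. *)
Theorem fiber_bound (R : realType) : exists2 C : R, 0 < C &
  forall (a : int) (s h : nat) (M : R) (t : seq nat),
    a != 0 -> (0 < h)%N -> (0 < s <= 2)%N -> 2 <= M -> uniq t ->
    (forall n, n \in t -> n%:R <= M) ->
    (forall n, n \in t -> exists q b, prime q /\ n = (q ^ b.+1)%N) ->
    (forall n, n \in t -> exists2 p, prime p & p%:Z = (s * h * n)%N%:Z - a) ->
    (size t)%:R <= C * (totient_ratio R `|a| * totient_ratio R h) * (M / ln M ^+ 2).
Proof.
exists 1792 => // a s h M t a0 h0 s12 M2 ut tM tq tp.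
set m := Num.truncn M; have M0 : 0 <= M by lra.
have /andP[mM Mm] := truncn_itv M0.
have m2 : (2 <= m)%N by rewrite truncn_ge_nat.
have tm n : n \in t -> (n <= m)%N by move=> /tM; rewrite /m truncn_ge_nat.
have m0 : (0 < m)%N by apply: leq_trans m2.
have [d d0 /andP[dm md]] := expn16_bracket m0.
have := fiber_count h0 s12 (d ^ 2) ut tm tq tp.
rewrite -addnA -(ler_nat R) => H; apply: le_trans H _.
rewrite natrD.
set r := sieve_residue _ _ _.
have adm p : prime p -> admissible r p by apply: sieve_residue_admissible.
set ps := primes_upto _.
have ups : uniq ps by apply/filter_uniq/iota_uniq.
have adp p : p \in ps -> admissible r p by rewrite mem_primes_upto => /andP[/adm].
have aps : all prime ps by exact: filter_all.
have D0 : (0 < d ^ 2)%N by rewrite expn_gt0 d0.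
have a1 : (0 < `|a|)%N by rewrite absz_gt0.
set F := totient_ratio R _ * _.
have F1 : 1 <= F by apply: mulr_ege1; apply: totient_ratio_ge1.
have PF : sieve_singular R r ps <= 3 * F.
  rewrite /F mulrA; apply: sieve_singular_le => // p pps r0.
  apply: contraT => pE; have [_ + _] := sieve_residueP s12 (allP aps p pps) pE.
  by rewrite -/r r0.
have S := selberg_sieve R m.+1 ups adp D0.
have G1 := sieve_sum_ge1 R adp D0.
have L := sieve_sum_ge R d adm; rewrite -/ps in L.
set G := sieve_sum _ _ _ _ in G1 L S.
have E := sieve_error_le M2 mM d0 dm.
set u := ln M in E *; have u0 : 0 < u by apply: ln_gt0; lra.
(* here [M < (d + 1) ^ 16] turns the level [d] into [ln M], whence 768 = 3 * 16 ^ 2 *)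
have ud : u <= 16 * ln d.+1%:R.
  rewrite mulr_natl -lnXn // ler_ln ?posrE ?exprn_gt0 //; last lra.
  by apply: ltW; apply: lt_le_trans Mm _; rewrite -natrX ler_nat.
have G0 : 0 < G by lra.
have u2 : u ^+ 2 <= 768 * F * G.
  apply: (@le_trans _ _ ((16 * ln d.+1%:R) ^+ 2)).
    by rewrite ler_pXn2r ?nnegrE ?(ltW u0) ?mulr_ge0 ?ln_nat_ge0.
  rewrite exprMn; have : sieve_singular R r ps * G <= 3 * F * G by rewrite ler_pM2r.
  lra.
have mG : m.+1%:R / G <= 1536 * F * (M / u ^+ 2).
  rewrite ler_pdivrMr //.
  have mM2 : m.+1%:R <= 2 * M by rewrite -natr1 -/m in mM *; lra.
  apply: le_trans mM2 _.
  rewrite [leRHS](_ : _ = 2 * M * ((768 * F * G) / u ^+ 2)); last by field; lra.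
  by rewrite ler_peMr ?mulr_ge0 // ler_pdivlMr ?mul1r // exprn_gt0.
have V0 : 0 <= M / u ^+ 2 by rewrite divr_ge0 // exprn_ge0 // ltW.
have : 256 * (M / u ^+ 2) <= 256 * (F * (M / u ^+ 2)).
  by rewrite ler_pM2l // ler_peMl.
move: S E mG; set X := M / u ^+ 2 => S E mG EF.
rewrite [leRHS](_ : _ = 1536 * F * X + 256 * (F * X)); last by ring.
lra.
Qed.

(** * Sums of multiplicative functions over integers with k prime factors *)

Definition smooth_omega (N y k : nat) : seq nat :=
  [seq h <- iota 1 N | (omega h == k) && all (fun p => p <= y)%N (primes h)].

Lemma mem_smooth_omega N y k h : (h \in smooth_omega N y k) =
  [&& omega h == k, all (fun p => p <= y)%N (primes h), (0 < h)%N & (h <= N)%N].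
Proof. by rewrite mem_filter mem_iota add1n ltnS -andbA. Qed.

Lemma primes_mulX p v m : prime p -> coprime p m -> (0 < m)%N -> (0 < v)%N ->
  perm_eq (primes (m * p ^ v)) (p :: primes m).
Proof.
move=> pp pm m0 v0; have p0 := prime_gt0 pp.
apply: uniq_perm; first exact: primes_uniq.
  rewrite /= primes_uniq andbT mem_primes pp m0 /=.
  by move: pm; rewrite prime_coprime.
move=> q; rewrite primesM ?expn_gt0 ?p0 // primesX // (primes_prime pp).
by rewrite !inE orbC.
Qed.

Definition nonneg_multiplicative (R : realFieldType) (F : nat -> R) : Prop :=
  [/\ forall n, 0 <= F n, F 1%N = 1 &
      forall m n, (0 < m)%N -> (0 < n)%N -> coprime m n -> F (m * n)%N = F m * F n].

Definition prime_power_sum (R : realFieldType) (F : nat -> R) (N y : nat) : R :=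
  \sum_(0 <= p < y.+1 | prime p) \sum_(1 <= v < N.+1) F (p ^ v)%N.

Lemma prime_power_sum_ge0 (R : realFieldType) (F : nat -> R) N y :
  (forall n, 0 <= F n) -> 0 <= prime_power_sum F N y.
Proof. by move=> F0; apply: sumr_ge0 => p _; apply: sumr_ge0. Qed.

(** Each [h] with [k.+1] prime factors is [p ^ v * h'] in [k.+1] ways. *)
Lemma smooth_omega_step (R : realFieldType) (F : nat -> R) N y k :
  nonneg_multiplicative F ->
  k.+1%:R * \sum_(h <- smooth_omega N y k.+1) F h
  <= prime_power_sum F N y * \sum_(h <- smooth_omega N y k) F h.
Proof.
move=> [F0 F1 FM]; set T := smooth_omega N y k.
have E h : h \in smooth_omega N y k.+1 ->
  k.+1%:R * F h = \sum_(0 <= p < y.+1 | prime p) \sum_(1 <= v < N.+1)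
     (if v == logn p h then F (p ^ v)%N * F (h %/ p ^ v)%N else 0).
  rewrite mem_smooth_omega => /and4P[/eqP hk /allP hy h0 hN].
  transitivity (\sum_(0 <= p < y.+1 | prime p) (if p \in primes h then F h else 0)).
    rewrite -big_mkcondr /= -big_filter.
    have pe : perm_eq [seq p <- index_iota 0 y.+1 | prime p && (p \in primes h)] (primes h).
      apply: uniq_perm; rewrite ?filter_uniq ?iota_uniq ?primes_uniq // => p.
      rewrite mem_filter mem_index_iota /= ltnS; case ph: (p \in primes h); rewrite ?andbF //.
      by rewrite (hy p ph) !andbT; move: ph; rewrite mem_primes => /andP[].
    by rewrite (perm_big _ pe) /= big_const_seq count_predT -hk iter_addr_0 mulr_natl.
  apply: eq_bigr => p pp.
  have lN : (logn p h < N.+1)%N.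
    by rewrite ltnS; apply: leq_trans hN; apply/ltnW/ltn_logl.
  rewrite -big_mkcond big_nat1_eq lN andbT logn_gt0; case: ifP => // ph.
  have [m pm hE] := pfactor_coprime pp h0.
  set v := logn p h in hE *.
  have pv : (0 < p ^ v)%N by rewrite expn_gt0 prime_gt0.
  have m0 : (0 < m)%N by move: h0; rewrite hE muln_gt0 => /andP[].
  by rewrite {1 2}hE mulnK // mulnC FM // coprimeXl.
rewrite mulr_sumr (eq_big_seq _ E) exchange_big /= /prime_power_sum mulr_suml.
apply: ler_sum => p pp; rewrite exchange_big /= mulr_suml.
apply: ler_sum_nat => v /andP[v0 vN].
rewrite -big_mkcond /= -mulr_sumr; apply: ler_wpM2l => //.
rewrite -[leLHS]big_filter.
have dec h : h \in [seq h <- smooth_omega N y k.+1 | v == logn p h] ->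
    exists m, [/\ h = (m * p ^ v)%N, m = (h %/ p ^ v)%N & m \in T].
  rewrite mem_filter mem_smooth_omega => /andP[/eqP vE /and4P[/eqP hk /allP hy h0 hN]].
  have [m pm hE] := pfactor_coprime pp h0.
  rewrite -vE in hE.
  have pv : (0 < p ^ v)%N by rewrite expn_gt0 prime_gt0.
  have m0 : (0 < m)%N by move: h0; rewrite hE muln_gt0 => /andP[].
  have pe := primes_mulX pp pm m0 v0.
  exists m; split => //; first by rewrite hE mulnK.
  rewrite mem_smooth_omega m0 (leq_trans _ hN) ?andbT; last by rewrite hE leq_pmulr.
  apply/andP; split.
    by move: hk; rewrite /omega hE (perm_size pe) /= => -[->].
  by apply/allP => q qm; apply: hy; rewrite hE (perm_mem pe) inE qm orbT.
apply: (ler_sum_inj (f := fun h => (h %/ p ^ v)%N) (F := F)).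
- by rewrite !filter_uniq // iota_uniq.
- by move=> h h' /dec[m [hE mE _]] /dec[m' [hE' mE' _]] e; rewrite hE hE' mE mE' e.
- by move=> h /dec[m [_ <- ]].
- by [].
Qed.

Lemma smooth_omega_sum_le (R : realFieldType) (F : nat -> R) N y k :
  nonneg_multiplicative F ->
  \sum_(h <- smooth_omega N y k) F h <= prime_power_sum F N y ^+ k / k`!%:R.
Proof.
move=> mF; have [F0 F1 _] := mF.
elim: k => [|k IH].
  have -> : prime_power_sum F N y ^+ 0 / 0`!%:R = \sum_(h <- [:: 1%N]) F h.
    by rewrite expr0 fact0 divr1 big_seq1 F1.
  apply: (ler_sum_inj (f := id)) => //; first by rewrite filter_uniq ?iota_uniq.
  move=> h; rewrite mem_smooth_omega => /and4P[/eqP/size0nil h1 _ h0 _].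
  by move/eqP: h1; rewrite primes_eq0 inE; lia.
have S0 := prime_power_sum_ge0 N y F0.
have k0 : 0 < k.+1%:R :> R by rewrite ltr0n.
rewrite -(ler_pM2l k0); apply: le_trans (smooth_omega_step N y k mF) _.
apply: le_trans (ler_wpM2l S0 IH) _.
rewrite le_eqVlt; apply/orP; left; apply/eqP.
rewrite factS natrM exprS invfM.
by rewrite [RHS]mulrCA mulVKf ?gt_eqF // mulrA.
Qed.

(** The exponential is [n ^ delta]: this is the summand of Rankin's method. *)
Definition rankin_term (R : realType) (delta : R) (n : nat) : R :=
  expR (delta * ln n%:R) / (totient n)%:R.

Lemma rankin_term_multiplicative (R : realType) (delta : R) :
  nonneg_multiplicative (rankin_term delta).
Proof.
split=> [n||m n m0 n0 mn]; first by rewrite divr_ge0 // expR_ge0.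
  by rewrite /rankin_term ln1 mulr0 expR0 divr1.
rewrite /rankin_term totient_coprime // !natrM lnM ?posrE ?ltr0n // mulrDr expRD invfM.
by rewrite mulrACA.
Qed.

Lemma geometric_sum_le (R : realFieldType) (q : R) (N : nat) :
  0 <= q < 1 -> \sum_(1 <= v < N.+1) q ^+ v <= q / (1 - q).
Proof.
move=> /andP[q0 q1]; have d : 0 < 1 - q by lra.
have -> : \sum_(1 <= v < N.+1) q ^+ v = (q - q ^+ N.+1) / (1 - q).
  elim: N => [|N IH]; first by rewrite big_geq // expr1 subrr mul0r.
  rewrite big_nat_recr //= IH [q ^+ N.+2]exprS; field; lra.
by rewrite ler_pM2r ?invr_gt0 // gerBl exprn_ge0.
Qed.

Lemma expR_le_quarter (R : realType) (t : R) : 0 <= t <= 1 / 4 ->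
  1 <= expR t <= 4 / 3 /\ expR t - 1 <= 4 / 3 * t.
Proof.
move=> /andP[t0 t1].
have e1 : 1 <= expR t by rewrite -[leLHS]expR0 ler_expR.
have e2 := expR_ge1Dx (- t); rewrite expRN in e2.
have e3 : (1 - t) * expR t <= 1.
  by rewrite -ler_pdivlMr ?expR_gt0 // mul1r.
split; last nra.
by rewrite e1 /=; nra.
Qed.

(** With [b = p ^ delta <= 4 / 3] the left side is the sum of the powers of [b / p]
    times [p / (p - 1)], that is [b / p + O(1 / p ^ 2)]; and [b - 1] is at most
    [4 / 3 * delta * ln p]. *)
Lemma euler_factor_le (R : realType) (delta : R) (p N : nat) : prime p ->
  0 <= delta * ln p%:R <= 1 / 4 ->
  \sum_(1 <= v < N.+1) rankin_term delta (p ^ v)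
  <= p%:R^-1 + 4 / 3 * delta * (ln p%:R / p%:R) + 19 / p%:R ^+ 2.
Proof.
move=> pp; set t := delta * ln p%:R => t14.
have [/andP[b1 b2] b3] := expR_le_quarter t14.
set b := expR t in b1 b2 b3.
have p2 : 2 <= p%:R :> R by rewrite ler_nat prime_gt1.
have -> : 4 / 3 * delta * (ln p%:R / p%:R) = 4 / 3 * t / p%:R by rewrite /t; ring.
set P : R := p%:R in p2 *.
have -> : \sum_(1 <= v < N.+1) rankin_term delta (p ^ v)
    = P / (P - 1) * \sum_(1 <= v < N.+1) (b / P) ^+ v.
  rewrite mulr_sumr big_nat [RHS]big_nat; apply: eq_bigr => v /andP[v0 _].
  rewrite /rankin_term totient_pfactor // natrX lnXn ?ltr0n ?prime_gt0 //.
  have -> : delta * (ln p%:R *+ v) = v%:R * t by rewrite /t -(mulr_natl (ln _)); ring.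
  rewrite expRM_natl -/b natrM natrX.
  have -> : p.-1%:R = P - 1 by rewrite -subn1 natrB ?prime_gt0.
  have PE : P ^+ v = P * P ^+ v.-1 by rewrite -exprS prednK.
  have X0 : P ^+ v.-1 != 0 by rewrite expf_neq0 // gt_eqF //; lra.
  rewrite -/P expr_div_n PE; move: (b ^+ v) (P ^+ v.-1) X0 => B X X0.
  field; rewrite X0 /=; lra.
have q01 : 0 <= b / P < 1.
  by rewrite divr_ge0 /= ?ltr_pdivrMr; lra.
apply: le_trans (ler_wpM2l _ (geometric_sum_le N q01)) _.
  by apply: divr_ge0; lra.
have -> : P / (P - 1) * (b / P / (1 - b / P))
   = P^-1 + (b - 1) / P + b * ((1 + b) * P - b) / (P * ((P - 1) * (P - b))).
  by field; lra.
apply: lerD.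
  by rewrite lerD2l ler_pM2r ?invr_gt0 //; lra.
have bb : b * (1 + b) <= 28 / 9.
  have : b * (1 + b) <= 4 / 3 * (7 / 3) by apply: ler_pM; lra.
  lra.
have n1 : b * ((1 + b) * P - b) <= 28 / 9 * P.
  have := sqr_ge0 b; have : b * (1 + b) * P <= 28 / 9 * P by rewrite ler_pM2r //; lra.
  lra.
have n0 : 0 <= b * ((1 + b) * P - b).
  have : 1 * 2 <= (1 + b) * P by apply: ler_pM; lra.
  by move=> ?; apply: mulr_ge0; lra.
have d1 : P * (P ^+ 2 / 6) <= P * ((P - 1) * (P - b)) by rewrite ler_pM2l; nra.
have P0 : 0 < P by lra.
have d0 : 0 < P * (P ^+ 2 / 6) by rewrite mulr_gt0 // divr_gt0 // exprn_gt0.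
have d0' := lt_le_trans d0 d1.
apply: (@le_trans _ _ (28 / 9 * P / (P * (P ^+ 2 / 6)))).
  by apply: ler_pM; rewrite // ?invr_ge0 ?lef_pV2 ?posrE // ltW.
have -> : 28 / 9 * P / (P * (P ^+ 2 / 6)) = 56 / 3 / P ^+ 2 by field; lra.
by rewrite ler_pM2r ?invr_gt0 ?exprn_gt0 //; lra.
Qed.

Lemma sum_inv_sqr_le1 (R : realFieldType) (n : nat) :
  \sum_(0 <= p < n.+1 | prime p) (p%:R ^+ 2)^-1 <= 1 :> R.
Proof.
case: n => [|n]; first by rewrite unlock /=; lra.
apply: (@le_trans _ _ (1 - n.+1%:R^-1)); last by rewrite gerBl invr_ge0.
elim: n => [|n IH]; first by rewrite unlock /= invr1 subrr.
rewrite big_mkcond big_nat_recr //= -big_mkcond /=.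
have H : (n.+2%:R ^+ 2)^-1 <= n.+1%:R^-1 - n.+2%:R^-1 :> R.
  rewrite -[n.+2%:R]natr1; set x : R := n.+1%:R.
  have x0 : 0 < x by rewrite ltr0n.
  rewrite -subr_ge0.
  have -> : x^-1 - (x + 1)^-1 - ((x + 1) ^+ 2)^-1 = (x * (x + 1) ^+ 2)^-1 by field; lra.
  by rewrite invr_ge0 mulr_ge0 ?sqr_ge0 // ltW.
have z : 0 <= (n.+2%:R ^+ 2)^-1 :> R by rewrite invr_ge0 sqr_ge0.
set S := \sum_(_ <= _ < _ | _) _ in IH *.
move: H z IH; move: (n.+2%:R ^- 2) (n.+1%:R^-1) (n.+2%:R^-1) => u v w H z IH.
by case: ifP => _; lra.
Qed.

Lemma lnln_ge (R : realType) (Y : R) : 2 <= Y -> -1 <= ln (ln Y).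
Proof.
move=> Y2; have [l1 l2] := ln2_bounds R.
have lY : ln 2 <= ln Y by rewrite ler_ln ?posrE //; lra.
apply: (@le_trans _ _ (ln (1 / 2))).
  by rewrite mul1r lnV ?posrE //; lra.
by rewrite ler_ln ?posrE //; lra.
Qed.

(** By Mertens, the three terms of [euler_factor_le] sum to [ln (ln y) + O(1)],
    [O(delta * (ln y + 1))] and [O(1)], and [delta * ln y] is bounded. *)
Lemma rankin_prime_power_sum_le (R : realType) : exists2 c : R, 1 <= c &
  forall (delta Y : R) (N y : nat), 0 <= delta -> delta * ln y%:R <= 1 / 4 ->
    2 <= Y -> y%:R <= Y ->
    prime_power_sum (rankin_term delta) N y <= ln (ln Y) + c.
Proof.
have [c0 Hc] := mertens_second_le R; have [l1 l2] := ln2_bounds R.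
exists (`|c0| + 22); first by have := normr_ge0 c0; lra.
move=> delta Y N y d0 dy Y2 yY.
have c0n := ler_norm c0; have c00 := normr_ge0 c0.
have lY : ln 2 <= ln Y by rewrite ler_ln ?posrE //; lra.
have llY := lnln_ge Y2.
case: (ltnP y 2) => y2.
  rewrite /prime_power_sum big_nat_cond big1; first lra.
  by move=> p /andP[/andP[_ py] /prime_gt1]; rewrite ltnNge -ltnS (leq_trans py).
have y0 : (0 < y)%N by exact: ltnW.
have lny : ln 2 <= ln y%:R :> R by rewrite ler_ln ?posrE ?ltr0n ?ler_nat.
have dd : delta <= 1 / 2.
  have : delta * (1 / 2) <= delta * ln y%:R by apply: ler_wpM2l; lra.
  lra.
apply: (@le_trans _ _ (\sum_(0 <= p < y.+1 | prime p)
  (p%:R^-1 + 4 / 3 * delta * (ln p%:R / p%:R) + 19 / p%:R ^+ 2))).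
  rewrite /prime_power_sum big_nat_cond [leRHS]big_nat_cond.
  apply: ler_sum => p /andP[/andP[_ py] pp]; apply: euler_factor_le => //.
  rewrite mulr_ge0 ?ln_nat_ge0 //=; apply: le_trans dy; apply: ler_wpM2l => //.
  by rewrite ler_ln ?posrE ?ltr0n ?ler_nat // prime_gt0.
rewrite !big_split /= -!mulr_sumr.
have m2 := Hc y y2.
have m1 : \sum_(0 <= p < y.+1 | prime p) ln p%:R / p%:R <= ln y%:R + ln 4 :> R.
  exact: mertens_first_le.
have m3 := sum_inv_sqr_le1 R y.
have l4 : ln 4 = 2 * ln 2 :> R.
  by rewrite mulr_natl -lnXn //; congr ln; ring.
have mm : delta * \sum_(0 <= p < y.+1 | prime p) ln p%:R / p%:R <= 5 / 4.
  apply: le_trans (ler_wpM2l d0 m1) _; rewrite mulrDr l4.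
  have : delta * (2 * ln 2) <= 1 / 2 * 2 by apply: ler_pM => //; lra.
  lra.
have yY' : ln (ln y%:R) <= ln (ln Y).
  by rewrite ler_ln ?posrE ?ler_ln ?posrE ?ltr0n //; lra.
rewrite -[4 / 3 * delta * _]mulrA.
lra.
Qed.

Lemma geometric_half_le2 (R : realFieldType) (J : nat) :
  \sum_(0 <= j < J) (2 ^+ j)^-1 <= 2 :> R.
Proof.
suff : \sum_(0 <= j < J) (2 ^+ j)^-1 <= 2 - 2 * (2 ^+ J)^-1 :> R.
  by move=> H; apply: le_trans H _; rewrite gerBl mulr_ge0 // invr_ge0 exprn_ge0.
elim: J => [|J IH]; first by rewrite big_geq // expr0 invr1; lra.
rewrite big_nat_recr //= exprS invfM; set x := (2 ^+ J)^-1 in IH *; lra.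
Qed.

Lemma pow4_expR_le (R : realType) (j : nat) :
  4 ^+ j * expR (- (2 ^+ j / 4)) <= 384 * (2 ^+ j)^-1 :> R.
Proof.
have z0 : 0 < 2 ^+ j :> R by rewrite exprn_gt0.
have -> : 4 ^+ j = 2 ^+ j * 2 ^+ j :> R by rewrite -exprMn; congr (_ ^+ _); ring.
set z : R := 2 ^+ j in z0 *.
have := @expR_ge_exprn R (z / 4) 2 (ltW (divr_gt0 z0 (ltr0n _ 4))).
rewrite (_ : 3`! = 6)%N // => H.
rewrite expRN ler_pdivrMr ?expR_gt0 //.
have zi : 0 < z^-1 by rewrite invr_gt0.
apply: le_trans (ler_wpM2l _ H); last by rewrite mulr_ge0 // ltW.
by rewrite [leRHS](_ : _ = z * z) //; field; lra.
Qed.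

(** * Rankin's method in ranges of ln (Y / h) *)

Definition range_index (R : realType) (L u : R) : nat := trunc_log 2 (Num.truncn (L / u)).

Lemma range_indexP (R : realType) (L u : R) : 1 / 2 <= u <= L ->
  [/\ 2 ^+ range_index L u * u <= L, L <= 2 * 2 ^+ range_index L u * u &
      (range_index L u < (Num.truncn (2 * L)).+1)%N].
Proof.
move=> /andP[u2 uL]; have u0 : 0 < u by lra.
have Lu : 1 <= L / u by rewrite ler_pdivlMr // mul1r.
have Lu0 : 0 <= L / u by lra.
have /andP[t1 t2] := truncn_itv Lu0.
have t0 : (0 < Num.truncn (L / u))%N by rewrite truncn_gt0.
rewrite /range_index; set m := Num.truncn (L / u) in t0 t1 t2 *.
have b1 := trunc_logP (isT : 1 < 2)%N t0.
have b2 := trunc_log_ltn m (isT : 1 < 2)%N.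
set j := trunc_log 2 m in b1 b2 *.
have b1' : 2 ^+ j <= m%:R :> R by rewrite -natrX ler_nat.
have b2' : m.+1%:R <= 2 ^+ j.+1 :> R by rewrite -natrX ler_nat.
split.
- by rewrite -ler_pdivlMr //; lra.
- by rewrite -ler_pdivrMr // -exprS; lra.
- rewrite ltnS; apply: (@leq_trans m).
    by apply: leq_trans b1; apply/ltnW/ltn_expl.
  rewrite truncn_ge_nat; last lra.
  apply: (le_trans t1); rewrite ler_pdivrMr //.
  have : 2 * L * (1 / 2) <= 2 * L * u by rewrite ler_pM2l //; lra.
  lra.
Qed.

(** Rankin's bound in one range of [u = ln (Y / h)]: there [h >= Y ^ (1 - 2^-j)],
    so with [delta = 2 ^ j / (4 ln Y)] the factor [h ^ delta] is at least
    [exp ((2 ^ j - 1) / 4)], more than enough for the loss [4 ^ j] in [1 / u ^ 2]. *)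
Lemma range_term_le (R : realType) (Y : R) (h j : nat) :
  let L := ln Y in let u := ln (Y / h%:R) in
  2 <= Y -> (0 < h)%N -> 0 < u -> 2 ^+ j * u <= L -> L <= 2 * 2 ^+ j * u ->
  (totient h)%:R^-1 / u ^+ 2
  <= 2048 / L ^+ 2 * (2 ^+ j)^-1 * rankin_term (2 ^+ j / (4 * L)) h.
Proof.
move=> L u Y2 h0 u0 uL Lu.
have L0 : 0 < L by apply: ln_gt0; lra.
have h0' : 0 < h%:R :> R by rewrite ltr0n.
have uE : u = L - ln h%:R by rewrite /u ln_div ?posrE //; lra.
have := pow4_expR_le R j.
have -> : 4 ^+ j = 2 ^+ j * 2 ^+ j :> R by rewrite -exprMn; congr (_ ^+ _); ring.
have z0 : 0 < 2 ^+ j :> R by rewrite exprn_gt0.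
set z : R := 2 ^+ j in uL Lu z0 * => P4.
have zi : 0 < z^-1 by rewrite invr_gt0.
rewrite /rankin_term; set T := (totient h)%:R^-1.
have T0 : 0 <= T by rewrite invr_ge0.
rewrite [leRHS](_ : _ = T * (2048 / L ^+ 2 * z^-1 * expR (z / (4 * L) * ln h%:R))); last by ring.
apply: ler_wpM2l => //.
have E : expR (z / 4 - 1 / 4) <= expR (z / (4 * L) * ln h%:R).
  rewrite ler_expR.
  have -> : ln h%:R = L - u by rewrite uE; ring.
  have -> : z / (4 * L) * (L - u) = z / 4 - (z * u) / L / 4 by field; lra.
  by rewrite lerD2l lerN2 ler_pM2r ?ler_pdivrMr ?mul1r //; lra.
have [/andP[_ q1] _] := @expR_le_quarter R (1 / 4) ltac:(lra).
have iu : (u ^+ 2)^-1 <= 4 * (z * z) / L ^+ 2.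
  have u2 : 0 < u ^+ 2 by apply: exprn_gt0.
  have L2 : 0 < L ^+ 2 by apply: exprn_gt0.
  rewrite ler_pdivlMr // mulrC ler_pdivrMr //.
  have : L ^+ 2 <= (2 * z * u) ^+ 2 by rewrite ler_pXn2r // nnegrE; lra.
  by rewrite [X in _ <= X -> _](_ : _ = 4 * (z * z) * u ^+ 2) //; ring.
apply: le_trans iu _.
have Li : 0 < (L ^+ 2)^-1 by rewrite invr_gt0 exprn_gt0.
(* 2048 is 4 * 384 * (4 / 3), with 384 from [pow4_expR_le] and 4 / 3 above [expR (1 / 4)] *)
have E1 : 1 <= expR (z / 4 - 1 / 4) * expR (1 / 4) * expR (- (z / 4)).
  rewrite -!expRD.
  by rewrite (_ : z / 4 - 1 / 4 + 1 / 4 + - (z / 4) = 0) ?expR0 //; ring.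
have e0 := expR_gt0 (z / 4 - 1 / 4); have e1 := expR_gt0 (1 / 4 : R).
set A := expR (z / 4 - 1 / 4) in E E1 e0; set B := expR (1 / 4) in q1 E1 e1.
set D := expR (- (z / 4)) in P4 E1.
have D0 : 0 < D by apply: expR_gt0.
have zz0 : 0 < z * z by rewrite mulr_gt0.
have S1 : z * z <= (z * z * D) * (A * B).
  by rewrite -[leLHS]mulr1 -!mulrA !ler_pM2l //; rewrite [leRHS](_ : _ = A * B * D) //; ring.
have S2 : (z * z * D) * (A * B) <= 384 * z^-1 * (A * (4 / 3)).
  apply: ler_pM => //; try by rewrite ltW ?mulr_gt0.
  by rewrite ler_pM2l.
have S3 := le_trans S1 S2.
apply: (@le_trans _ _ (4 * (384 * z^-1 * (A * (4 / 3))) / L ^+ 2)).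
  by rewrite ler_pM2r // ler_pM2l.
rewrite [leLHS](_ : _ = 2048 / L ^+ 2 * z^-1 * A); last by field; lra.
by apply: ler_wpM2l => //; rewrite !mulr_ge0 // ltW.
Qed.

(** Each [h] is charged to the range [j] of its logarithm; the weights of the
    ranges form a convergent geometric series. *)
Theorem totient_log_sum_le (R : realType) : exists2 c : R, 1 <= c &
  forall (Y : R) (N k : nat) (hs : seq nat), 2 <= Y -> uniq hs ->
    (forall h, h \in hs -> [/\ (0 < h <= N)%N, omega h = k, 2 * h%:R <= Y &
        forall q, q \in primes h -> q%:R * h%:R <= Y]) ->
    \sum_(h <- hs) (totient h)%:R^-1 / ln (Y / h%:R) ^+ 2
    <= 4096 * (ln (ln Y) + c) ^+ k / k`!%:R / ln Y ^+ 2.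
Proof.
have [c c0 Hc] := rankin_prime_power_sum_le R; exists c => //.
move=> Y N k hs Y2 uhs H; have [l1 l2] := ln2_bounds R.
have Y0 : 0 < Y by apply: lt_le_trans Y2.
set L := ln Y; have L0 : 0 < L by apply: ln_gt0; lra.
(* in the [j]-th range the prime factors of [h] are at most [Y ^ (2 ^ - j)] *)
pose y j := Num.truncn (expR (L / 2 ^+ j)).
pose J := (Num.truncn (2 * L)).+1.
pose dl j : R := 2 ^+ j / (4 * L).
pose w j : R := 2048 / L ^+ 2 * (2 ^+ j)^-1.
have z0 j : 0 < 2 ^+ j :> R by rewrite exprn_gt0.
have w0 j : 0 <= w j by rewrite /w !mulr_ge0 ?invr_ge0 ?exprn_ge0 // ltW.
have rt0 j h : 0 <= rankin_term (dl j) h.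
  by have [F0 _ _] := rankin_term_multiplicative (dl j).
have point h : h \in hs -> (totient h)%:R^-1 / ln (Y / h%:R) ^+ 2 <=
    \sum_(0 <= j < J) (if h \in smooth_omega N (y j) k then w j * rankin_term (dl j) h else 0).
  move=> /H[/andP[h0 hN] hk h2 hq].
  have h0' : 0 < h%:R :> R by rewrite ltr0n.
  set u := ln (Y / h%:R).
  have Yh : 2 <= Y / h%:R by rewrite ler_pdivlMr.
  have Yh0 : 0 < Y / h%:R by apply: lt_le_trans Yh.
  have u2 : 1 / 2 <= u.
    by apply: le_trans l1 _; rewrite ler_ln ?posrE.
  have u0 : 0 < u by apply: lt_le_trans u2; rewrite divr_gt0.
  have uL : u <= L.
    by rewrite ler_ln ?posrE // ler_pdivrMr // ler_peMr ?ler1n // ltW.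
  have [j1 j2 j3] := range_indexP (introT andP (conj u2 uL)).
  set j := range_index L u in j1 j2 j3.
  have hS : h \in smooth_omega N (y j) k.
    rewrite mem_smooth_omega hk eqxx h0 hN !andbT /=; apply/allP => q qh.
    rewrite /y truncn_ge_nat ?expR_ge0 //.
    have q0 : 0 < q%:R :> R by rewrite ltr0n; move: qh; rewrite mem_primes => /andP[/prime_gt0].
    rewrite -[leLHS]lnK ?posrE // ler_expR.
    apply: (@le_trans _ _ u).
      by rewrite /u ler_ln ?posrE // ler_pdivlMr // hq.
    by rewrite ler_pdivlMr // mulrC.
  rewrite (@big_cat_nat _ _ _ j.+1) //= big_nat_recr //= hS.
  have S0 m n : 0 <= \sum_(m <= i < n) (if h \in smooth_omega N (y i) k then w i * rankin_term (dl i) h else 0).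
    by apply: sumr_ge0 => i _; case: ifP => _ //; rewrite mulr_ge0.
  have P : (totient h)%:R^-1 / u ^+ 2 <= w j * rankin_term (dl j) h.
    exact: range_term_le.
  apply: le_trans P _; rewrite -[leLHS]add0r -[leLHS]addr0.
  by rewrite lerD ?S0 // lerD.
have tot : \sum_(h <- hs) (totient h)%:R^-1 / ln (Y / h%:R) ^+ 2 <=
    \sum_(0 <= j < J) w j * ((ln (ln Y) + c) ^+ k / k`!%:R).
  apply: (@le_trans _ _ (\sum_(h <- hs) \sum_(0 <= j < J)
     (if h \in smooth_omega N (y j) k then w j * rankin_term (dl j) h else 0))).
    by rewrite big_seq [leRHS]big_seq; apply: ler_sum.
  rewrite exchange_big /=; apply: ler_sum => j _.
  rewrite -big_mkcond /= -mulr_sumr; apply: ler_wpM2l => //.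
  apply: (@le_trans _ _ (\sum_(h <- smooth_omega N (y j) k) rankin_term (dl j) h)).
    rewrite -[leLHS]big_filter; apply: (ler_sum_inj (f := id)) => //.
      by rewrite filter_uniq.
    by move=> h; rewrite mem_filter => /andP[].
  apply: le_trans (smooth_omega_sum_le _ _ _ (rankin_term_multiplicative _)) _.
  have S0 : 0 <= prime_power_sum (rankin_term (dl j)) N (y j).
    exact: prime_power_sum_ge0.
  rewrite ler_pM2r ?invr_gt0 ?ltr0n ?fact_gt0 //.
  have e1 : 1 <= expR (L / 2 ^+ j).
    by rewrite -[leLHS]expR0 ler_expR divr_ge0 // ltW.
  have /andP[ye _] := truncn_itv (expR_ge0 (L / 2 ^+ j)); rewrite -/(y j) in ye.
  have yL : ln (y j)%:R <= L / 2 ^+ j.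
    rewrite -[leRHS]expRK ler_ln ?posrE ?expR_gt0 // ltr0n truncn_gt0 //.
  have Sb : prime_power_sum (rankin_term (dl j)) N (y j) <= ln (ln Y) + c.
    apply: Hc => //.
    - by rewrite /dl divr_ge0 // ltW // mulr_gt0.
    - have d0 : 0 < dl j by rewrite /dl divr_gt0 // mulr_gt0.
      apply: le_trans (ler_wpM2l (ltW d0) yL) _.
      by rewrite /dl le_eqVlt; apply/orP; left; apply/eqP; field; rewrite !gt_eqF.
    - apply: le_trans ye _; rewrite -[leRHS]lnK ?posrE; last lra.
      rewrite ler_expR ler_pdivrMr // -/L ler_peMr ?(ltW L0) //.
      by rewrite exprn_ege1 // ler1n.
  by apply: lerXn2r; rewrite ?nnegrE //; apply: le_trans S0 Sb.
apply: le_trans tot _; rewrite -mulr_suml.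
have g := geometric_half_le2 R J.
have X0 : 0 <= (ln (ln Y) + c) ^+ k / k`!%:R.
  apply: divr_ge0 => //; apply: exprn_ge0.
  have F0 n : 0 <= rankin_term 0 n :> R by have [] := rankin_term_multiplicative (0 : R).
  apply: le_trans (prime_power_sum_ge0 0%N 0%N F0) (Hc 0 Y 0%N 0%N _ _ _ _) => //.
    by rewrite mul0r divr_ge0.
  exact: ltW.
rewrite /w -mulr_sumr.
rewrite [leRHS](_ : _ = 2048 / L ^+ 2 * 2 * ((ln (ln Y) + c) ^+ k / k`!%:R)); last by ring.
apply: ler_wpM2r => //; apply: ler_wpM2l => //.
by rewrite divr_ge0 // exprn_ge0 // ltW.
Qed.

(** * Splitting off the largest prime power *)

Definition top_power (m : nat) : nat := (max_pdiv m ^ logn (max_pdiv m) m)%N.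

Definition top_cofactor (m : nat) : nat := (m %/ top_power m)%N.

Lemma top_power_split (m : nat) : (1 < m)%N ->
  [/\ m = (top_cofactor m * top_power m)%N,
      exists q b, prime q /\ top_power m = (q ^ b.+1)%N,
      omega (top_cofactor m) = (omega m).-1,
      (1 < top_power m)%N &
      forall q, q \in primes (top_cofactor m) -> (q <= top_power m)%N].
Proof.
move=> m1; have m0 := ltnW m1.
have pq := max_pdiv_prime m1; have qm := max_pdiv_dvd m.
set q := max_pdiv m in pq qm.
have [h qh mE] := pfactor_coprime pq m0.
have v0 : (0 < logn q m)%N by rewrite logn_gt0 mem_primes pq m0.
set v := logn q m in mE v0.
have tE : top_power m = (q ^ v)%N by [].
have pv : (0 < q ^ v)%N by rewrite expn_gt0 prime_gt0.
have hE : top_cofactor m = h by rewrite /top_cofactor tE [in LHS]mE mulnK.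
have h0 : (0 < h)%N by move: m0; rewrite mE muln_gt0 => /andP[].
have pe := primes_mulX pq qh h0 v0.
have qv : (q <= q ^ v)%N by rewrite -{1}(expn1 q) leq_exp2l // prime_gt1.
rewrite hE tE; split.
- exact: mE.
- by exists q, v.-1; rewrite prednK.
- by rewrite /omega [in RHS]mE (perm_size pe).
- by apply: leq_trans qv; exact: prime_gt1.
- move=> p ph; apply: leq_trans qv; apply: max_pdiv_max.
  rewrite -[p \in _]/(p \in primes m) [X in primes X]mE.
  by rewrite (perm_mem pe) inE ph orbT.
Qed.

Lemma size_eq_sum_fibers (f : nat -> nat) (ps : seq nat) :
  size ps = (\sum_(h <- undup (map f ps)) size [seq p <- ps | f p == h])%N.
Proof.
under eq_bigr do rewrite size_filter -sum1_count big_mkcond.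
rewrite exchange_big /= -sum1_size big_seq [RHS]big_seq.
apply: eq_bigr => p pps; rewrite -big_mkcond sum1_count.
rewrite (eq_count (a2 := pred1 (f p))); last by move=> h; rewrite /= eq_sym.
by rewrite count_uniq_mem ?undup_uniq // mem_undup map_f.
Qed.

Section ShiftedPrimes.
Variables (R : realType) (a : int) (k : nat) (x : R).
Hypotheses (k0 : (0 < k)%N) (xa : 2 * (`|a|%N)%:R <= x).

Let s : nat := if odd `|a| then 2%N else 1%N.

Definition shifted_primes : seq nat :=
  [seq p <- primes_le x | [&& - a < p%:Z, (parity_divisor a %| p%:Z + a)%Z &
     omega `|((p%:Z + a) %/ parity_divisor a)%Z| == k]].

Definition shifted_quotient (p : nat) : nat := `|((p%:Z + a) %/ parity_divisor a)%Z|.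

Lemma shifted_primesP p : p \in shifted_primes ->
  [/\ prime p, p%:Z = (s * shifted_quotient p)%N%:Z - a, omega (shifted_quotient p) = k,
      (1 < shifted_quotient p)%N & (shifted_quotient p)%:R <= 2 * x].
Proof.
rewrite mem_filter mem_filter mem_iota add0n.
move=> /andP[/and3P[ap sp /eqP ok] /andP[pp /= px]].
have x0 : 0 <= x by apply: le_trans xa; rewrite mulr_ge0.
have {}px : p%:R <= x by rewrite -truncn_ge_nat // -ltnS.
have sE : parity_divisor a = s%:Z by rewrite /parity_divisor /s; case: (odd _).
have s0 : (0 < s)%N by rewrite /s; case: (odd _).
have pa : 0 < p%:Z + a by rewrite -ltrBlDr sub0r.
have m1 : (1 < shifted_quotient p)%N.
  by rewrite ltnNge; apply: contraTN k0 => m1; rewrite -ok -/(shifted_quotient p);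
     case: (shifted_quotient p) m1 => [|[|]].
have q0 : 0 <= ((p%:Z + a) %/ s%:Z)%Z by rewrite divz_ge0 // ?ltW // ltz_nat.
have mE : (s * shifted_quotient p)%N%:Z = p%:Z + a.
  by rewrite /shifted_quotient sE PoszM gez0_abs // mulrC divzK // -sE.
split => //.
  by rewrite mE addrK.
have : ((s * shifted_quotient p)%N%:Z)%:~R = (p%:Z + a)%:~R :> R by rewrite mE.
rewrite intrD -!pmulrn natrM => E.
have aR : a%:~R <= (`|a|%N)%:R :> R.
  by rewrite pmulrn ler_int lez_abs.
have s1 : 1 <= s%:R :> R by rewrite ler1n.
have : 1 * (shifted_quotient p)%:R <= s%:R * (shifted_quotient p)%:R :> R.
  by rewrite ler_pM2r // ltr0n; apply: ltnW.
rewrite mul1r E => H; apply: le_trans H _; apply: le_trans (lerD px aR) _.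
by move: xa; move: (`|a|%N%:R : R) => n xn; lra.
Qed.

End ShiftedPrimes.

Theorem corollary1 (R : realType) :
  exists K C : R,
    [/\ 0 < K, 0 < C &
      forall (a : int) (k : nat) (x : R),
        a != 0 -> (0 < k)%N -> 2 * (`|a|%N)%:R <= x ->
        (shifted_prime_count a k x)%:R <=
          K * ((`|a|%N)%:R / (totient `|a|%N)%:R) * (prime_pi x)%:R
            * ((ln (ln x) + C) ^+ k.-1 / ((k.-1)`!%:R * ln x))].
Proof.
have [c1 c10 Hpi] := prime_pi_ge R.
have [c2 c20 Hfib] := fiber_bound R.
have [c3 c31 Hsum] := totient_log_sum_le R.
exists (c2 * 8192 / c1), (c3 + 1); split.
- by rewrite divr_gt0 // mulr_gt0.
- by apply: lt_le_trans (ltr01) _; rewrite lerDr; apply: le_trans c31.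
move=> a k x a0 k0 xa.
have a1 : 1 <= (`|a|%N)%:R :> R by rewrite ler1n absz_gt0.
have x2 : 2 <= x by apply: le_trans xa; rewrite ler_peMr.
have x0 : 0 < x by apply: lt_le_trans x2.
set Y := 2 * x; have Y2 : 2 <= Y by rewrite /Y; lra.
have Y0 : 0 < Y by apply: lt_le_trans Y2.
set ps := shifted_primes a k x.
have psP p : p \in ps -> _ := @shifted_primesP R a k x k0 xa p.
have ups : uniq ps by rewrite !filter_uniq ?iota_uniq.
have -> : shifted_prime_count a k x = size ps by rewrite size_filter.
set s : nat := if odd `|a| then 2%N else 1%N.
have s12 : (0 < s <= 2)%N by rewrite /s; case: (odd _).
set m := shifted_quotient a.
pose hf p := top_cofactor (m p).
pose nf p := top_power (m p).
set hs := undup (map hf ps).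
have hsP h : h \in hs -> exists2 p, p \in ps & h = hf p.
  by rewrite mem_undup => /mapP[p pps hE]; exists p.
have split p : p \in ps -> m p = (hf p * nf p)%N.
  by move=> /psP[_ _ _ m1 _]; have [E _ _ _ _] := top_power_split m1.
have hn0 p : p \in ps -> (0 < hf p)%N.
  move=> pps; have [_ _ _ m1 _] := psP p pps.
  have : (0 < hf p * nf p)%N by rewrite -split // ltnW.
  by rewrite muln_gt0 => /andP[].
have hnY p : p \in ps -> (nf p)%:R * (hf p)%:R <= Y.
  by move=> pps; have [_ _ _ _ mY] := psP p pps; rewrite -natrM mulnC -split.
pose N := Num.truncn Y.
have hs_ok h : h \in hs -> [/\ (0 < h <= N)%N, omega h = k.-1, 2 * h%:R <= Y &
        forall q, q \in primes h -> q%:R * h%:R <= Y].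
  move=> /hsP[p pps ->]; have [_ _ mk m1 mY] := psP p pps.
  have [_ _ ok n1 qn] := top_power_split m1.
  have h0 := hn0 p pps; have nhY := hnY p pps.
  split.
  - rewrite h0 /= truncn_ge_nat ?(ltW Y0) //; apply: le_trans nhY.
    by rewrite ler_peMl // ler1n ltnW.
  - by rewrite /hf ok; congr (_.-1).
  - by apply: le_trans nhY; rewrite ler_wpM2r // ler_nat.
  - by move=> q /qn qq; apply: le_trans nhY; rewrite ler_wpM2r // ler_nat.
have fib h : h \in hs -> (size [seq p <- ps | hf p == h])%:R <=
    c2 * totient_ratio R `|a| * Y * ((totient h)%:R^-1 / ln (Y / h%:R) ^+ 2).
  move=> hh; have [/andP[h0 _] _ h2 _] := hs_ok h hh.
  have h0' : 0 < h%:R :> R by rewrite ltr0n.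
  rewrite -(size_map nf).
  have M2 : 2 <= Y / h%:R by rewrite ler_pdivlMr.
  have mem n : n \in map nf [seq p <- ps | hf p == h] ->
      exists p, [/\ p \in ps, h = hf p & n = nf p].
    by move=> /mapP[p]; rewrite mem_filter => /andP[/eqP <- pps] ->; exists p.
  (* [p] is determined by [h] and [n], so that the fiber of [h] injects into the [n] *)
  have pE p : p \in ps -> p%:Z = (s * hf p * nf p)%N%:Z - a.
    by move=> pps; have [_ -> _ _ _] := psP p pps; rewrite -/m split // mulnA.
  have := @Hfib a s h (Y / h%:R) (map nf [seq p <- ps | hf p == h]) a0 h0 s12 M2.
  move=> /(_ _ _ _ _); rewrite /totient_ratio.
  rewrite [X in _ -> _ -> _ -> _ -> _ <= X](_ : _ = c2 * ((`|a|%N)%:R / (totient `|a|)%:R) * Y *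
     ((totient h)%:R^-1 / ln (Y / h%:R) ^+ 2)); last first.
    move: (_ / (totient `|a|)%:R) (ln _ ^+ 2)^-1 (totient h)%:R^-1 => T W t.
    rewrite [LHS](_ : _ = c2 * T * Y * (t * W) * (h%:R / h%:R)); last by ring.
    by rewrite mulfV ?mulr1 // gt_eqF.
  apply.
  - rewrite map_inj_in_uniq ?(filter_uniq _ ups) // => p p'.
    rewrite !(mem_filter _ _ ps) => /andP[/eqP ph pps] /andP[/eqP ph' pps'] nn.
    by have := pE p pps; rewrite ph nn -ph' -(pE p' pps') => -[].
  - by move=> n /mem[p [pps -> ->]]; rewrite ler_pdivlMr ?hnY // ltr0n hn0.
  - by move=> n /mem[p [/psP[_ _ _ m1 _] _ ->]]; have [_ ? _ _ _] := top_power_split m1.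
  - move=> n /mem[p [pps -> ->]]; exists p; last exact: pE.
    by have [] := psP p pps.
have T1 : 1 <= totient_ratio R `|a| by apply: totient_ratio_ge1; rewrite absz_gt0.
have T0 : 0 < totient_ratio R `|a| by apply: lt_le_trans T1.
have total : (size ps)%:R <= c2 * totient_ratio R `|a| * Y *
    (4096 * (ln (ln Y) + c3) ^+ k.-1 / (k.-1)`!%:R / ln Y ^+ 2).
  rewrite {1}(size_eq_sum_fibers hf) natr_sum -/hs.
  apply: (@le_trans _ _ (\sum_(h <- hs) c2 * totient_ratio R `|a| * Y * ((totient h)%:R^-1 / ln (Y / h%:R) ^+ 2))).
    by rewrite big_seq [leRHS]big_seq; apply: ler_sum.
  rewrite -mulr_sumr; apply: ler_wpM2l.
    exact: ltW (mulr_gt0 (mulr_gt0 c20 T0) Y0).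
  by apply: (Hsum Y N) => //; exact: undup_uniq.
apply: le_trans total _.
have [l1 l2] := ln2_bounds R.
have lx : ln 2 <= ln x by rewrite ler_ln ?posrE.
have lx0 : 0 < ln x by apply: lt_le_trans lx; apply: lt_le_trans l1; rewrite divr_gt0.
have lY : ln Y = ln 2 + ln x by rewrite lnM ?posrE.
have lY0 : 0 < ln Y by rewrite lY; lra.
have llY : ln (ln Y) <= ln (ln x) + 1.
  have : ln (ln Y) <= ln (2 * ln x) by rewrite ler_ln ?posrE ?mulr_gt0 //; lra.
  by rewrite lnM ?posrE //; lra.
have base0 : 0 <= ln (ln Y) + c3 by have := lnln_ge Y2; lra.
(* the passage from [Y = 2 x] to [x] adds at most 1 to the constant [c3] *)
have pw : (ln (ln Y) + c3) ^+ k.-1 <= (ln (ln x) + (c3 + 1)) ^+ k.-1.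
  by apply: lerXn2r; rewrite ?nnegrE; lra.
have ll : (ln Y ^+ 2)^-1 <= (ln x ^+ 2)^-1.
  rewrite lef_pV2 ?posrE ?exprn_gt0 // ler_pXn2r ?nnegrE ?ltW //.
  by rewrite lY; lra.
have {}Hpi := Hpi x x2.
rewrite -/(totient_ratio R `|a|).
move: (totient_ratio R `|a|) T0 pw ll Hpi base0 => T T0.
move: (ln (ln Y) + c3) (ln (ln x) + (c3 + 1)) => A B.
have f0 : 0 < (k.-1)`!%:R :> R by rewrite ltr0n fact_gt0.
move: (k.-1)`!%:R f0 => f f0 pw ll Hpi base0.
have A0 : 0 <= A ^+ k.-1 by apply: exprn_ge0.
move: (A ^+ k.-1) (B ^+ k.-1) A0 pw => P Q P0 PQ.
have H1 : P / ln Y ^+ 2 <= Q / ln x ^+ 2.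
  by apply: ler_pM => //; rewrite invr_ge0 exprn_ge0 // ltW.
have Q0 : 0 <= Q by apply: le_trans PQ.
have H2 : x / ln x <= (prime_pi x)%:R / c1 by rewrite ler_pdivlMr // mulrC.
have lxn : ln x != 0 by rewrite gt_eqF.
have fn : f != 0 by rewrite gt_eqF.
have c1n : c1 != 0 by rewrite gt_eqF.
apply: (@le_trans _ _ (c2 * T * 8192 * (x / f) * (Q / ln x ^+ 2))).
  rewrite [leLHS](_ : _ = c2 * T * 8192 * (x / f) * (P / ln Y ^+ 2)).
    by apply: ler_wpM2l => //; rewrite ltW // !mulr_gt0 // invr_gt0.
  by rewrite /Y; field; rewrite fn gt_eqF.
rewrite [leLHS](_ : _ = c2 * T * 8192 * (Q / (f * ln x)) * (x / ln x)); last first.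
  by field; rewrite lxn fn.
rewrite [leRHS](_ : _ = c2 * T * 8192 * (Q / (f * ln x)) * ((prime_pi x)%:R / c1)); last first.
  by field; rewrite c1n lxn fn.
apply: ler_wpM2l => //.
have Qf : 0 <= Q / (f * ln x) by rewrite divr_ge0 // ltW // mulr_gt0.
by rewrite mulr_ge0 // ltW // !mulr_gt0.
Qed.
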